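(* Let $q\in\mathbb{C}\setminus\{0,1\}$ and let $X$ be a left Fréchet $\mathcal{O}_q(\mathbb{C}^2)$-module given by a pair $(T,S)$ of continuous linear operators on $X$ with $TS=q^{-1}ST$. Then $$\sigma(T,S)=\mathbb{C}_{xy}\setminus\operatorname{res}(T,S).$$
   Context: The quantum plane is the free unital associative algebra $\mathfrak{A}_q=\mathbb{C}\langle x,y\rangle/(xy-q^{-1}yx)$. An Arens–Michael algebra is a complete locally convex algebra whose topology is defined by a family of multiplicative (submultiplicative) seminorms. $\mathcal{O}_q(\mathbb{C}^2)$ denotes the Arens–Michael envelope of $\mathfrak{A}_q$: the Arens–Michael algebra with a homomorphism $\omega:\mathfrak{A}_q\to\mathcal{O}_q(\mathbb{C}^2)$ such that every homomorphism from $\mathfrak{A}_q$ to an Arens–Michael (equivalently, Banach) algebra factors uniquely through $\omega$ by a continuous homomorphism; it is a Fréchet algebra. A left Fréchet $\mathcal{O}_q(\mathbb{C}^2)$-module $X$ is given by the pair $(T,S)$ if $x$ acts as $T$ and $y$ acts as $S$. The space of continuous characters of $\mathcal{O}_q(\mathbb{C}^2)$ is identified, via $\gamma\mapsto(\gamma(x),\gamma(y))$, with $\mathbb{C}_{xy}=(\mathbb{C}\times\{0\})\cup(\{0\}\times\mathbb{C})\subseteq\mathbb{C}^2$. For $\gamma\in\mathbb{C}_{xy}$, $\mathbb{C}(\gamma)$ is the trivial (one-dimensional) module on $\mathbb{C}$ given by the character $\gamma$ (here used as a right module). $\operatorname{Tor}_k^{\mathcal{O}_q(\mathbb{C}^2)}$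 is the Tor functor of topological homology (Helemskii, Taylor), computed by admissible projective resolutions in the category of Fréchet modules and the completed projective tensor product $\widehat{\otimes}$. The resolvent set $\operatorname{res}(T,S)$ is the set of those $\gamma\in\mathbb{C}_{xy}$ such that $\operatorname{Tor}_k^{\mathcal{O}_q(\mathbb{C}^2)}(\mathbb{C}(\gamma),X)=\{0\}$ for all $k\geq0$ (the transversality relation $\mathbb{C}(\gamma)\perp_{\mathcal{O}_q(\mathbb{C}^2)}X$). For $\gamma\in\mathbb{C}_{xy}$ let $\mathcal{K}((T,S),\gamma)$ be the complex $$0\to X\xrightarrow{d^0_\gamma}X\oplus X\xrightarrow{d^1_\gamma}X\to0,$$ $$d^0_\gamma(\theta)=\left((\gamma(y)-qS)\theta,\ (T-q\gamma(x))\theta\right),\qquad d^1_\gamma(\xi,\eta)=(T-\gamma(x))\xi+(S-\gamma(y))\eta.$$ The joint (Taylor) spectrum is $\sigma(T,S)=\{\gamma\in\mathbb{C}_{xy}:\mathcal{K}((T,S),\gamma)\text{ is not exact}\}$. *)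

(* Defs.v *)
From HB Require Import structures.
From mathcomp Require Import all_boot all_order all_algebra.
From mathcomp Require Import boolp.
From mathcomp Require monalg.

Set Implicit Arguments.
Unset Strict Implicit.
Unset Printing Implicit Defensive.

Import Order.TTheory GRing.Theory Num.Theory.

Local Open Scope ring_scope.

(* The quotient of an algebra by the two-sided ideal generated by one element;
   the quotients of ring_quotient only cover commutative rings. *)
Module PrincipalQuotient.
Section PrincipalQuotient.
Variables (K : nzRingType) (F : lalgType K) (r : F).

Definition two_sided_ideal (J : F -> Prop) : Prop :=
  [/\ J 0, forall u v, J u -> J v -> J (u - v),
      forall a u, J u -> J (a * u) & forall a u, J u -> J (u * a)].

Definition ideal_gen : {pred F} := fun g =>
  `[< forall J : F -> Prop, two_sided_ideal J -> J r -> J g >].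

Lemma ideal_gen_zmod : zmod_closed ideal_gen.
Proof.
split=> [|u v /asboolP hu /asboolP hv]; apply/asboolP=> J hJ hr.
  by case: hJ.
by case: (hJ) => _ hB _ _; apply: hB; [apply: hu|apply: hv].
Qed.

#[export]
HB.instance Definition _ := GRing.isZmodClosed.Build F ideal_gen ideal_gen_zmod.

Lemma ideal_gen_id : r \in ideal_gen.
Proof. exact/asboolP. Qed.

Lemma ideal_gen_mull a u : u \in ideal_gen -> a * u \in ideal_gen.
Proof.
move=> /asboolP hu; apply/asboolP=> J hJ hr.
by case: (hJ) => _ _ hl _; apply: hl; apply: hu.
Qed.

Lemma ideal_gen_mulr a u : u \in ideal_gen -> u * a \in ideal_gen.
Proof.
move=> /asboolP hu; apply/asboolP=> J hJ hr.
by case: (hJ) => _ _ _; apply; apply: hu.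
Qed.

Lemma ideal_gen_scale k u : u \in ideal_gen -> k *: u \in ideal_gen.
Proof. by move=> hu; rewrite -[u]mul1r scalerAl ideal_gen_mull. Qed.

Definition quot : Type := Quotient.quot ideal_gen.

#[export]
HB.instance Definition _ := GRing.Zmodule.on quot.

Definition proj (g : F) : quot := (\pi_(Quotient.quot ideal_gen) g)%qT.
Definition lift (u : quot) : F := repr u.

Lemma liftK u : proj (lift u) = u.
Proof. exact: reprK. Qed.

Lemma projE g h : proj g = proj h <-> g - h \in ideal_gen.
Proof.
rewrite (Quotient.idealrBE ideal_gen g h); split => [hgh|/eqP//].
exact/eqP.
Qed.

Lemma projD : {morph proj : g h / g + h}.
Proof. by move=> g h; rewrite /proj !piE. Qed.

Lemma proj0 : proj 0 = 0.
Proof. by apply: (addrI (proj 0)); rewrite -projD !addr0. Qed.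

Definition one := proj 1.
Definition mul u v := proj (lift u * lift v).
Definition scale k u := proj (k *: lift u).

Lemma projM : {morph proj : g h / g * h >-> mul g h}.
Proof.
move=> g h; apply/projE.
have hg : g - lift (proj g) \in ideal_gen by apply/projE; rewrite liftK.
have hh : h - lift (proj h) \in ideal_gen by apply/projE; rewrite liftK.
rewrite -[g * h](subrK (g * lift (proj h))) -addrA -mulrBr -mulrBl.
by apply: rpredD; [exact: ideal_gen_mull|exact: ideal_gen_mulr].
Qed.

Lemma projZ k : {morph proj : g / k *: g >-> scale k g}.
Proof.
move=> g; apply/projE; rewrite -scalerBr ideal_gen_scale//.
by apply/projE; rewrite liftK.
Qed.

Lemma mulA : associative mul.
Proof.
move=> u v w; rewrite -[u]liftK -[v]liftK -[w]liftK.
by rewrite -!projM mulrA.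
Qed.

Lemma mul1 : left_id one mul.
Proof. by move=> u; rewrite -[u]liftK -projM mul1r. Qed.

Lemma mulr1 : right_id one mul.
Proof. by move=> u; rewrite -[u]liftK -projM mulr1. Qed.

Lemma mulDl : left_distributive mul +%R.
Proof.
move=> u v w; rewrite -[u]liftK -[v]liftK -[w]liftK.
by rewrite -projD -!projM -projD mulrDl.
Qed.

Lemma mulDr : right_distributive mul +%R.
Proof.
move=> u v w; rewrite -[u]liftK -[v]liftK -[w]liftK.
by rewrite -projD -!projM -projD mulrDr.
Qed.

Lemma one_neq0 : 1 \notin ideal_gen -> one != 0.
Proof.
by move=> /negP h1; apply/eqP; rewrite -proj0 => /projE; rewrite subr0.
Qed.

Lemma scaleA a b u : scale a (scale b u) = scale (a * b) u.
Proof. by rewrite -[u]liftK -!projZ scalerA. Qed.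

Lemma scale1 : left_id 1 scale.
Proof. by move=> u; rewrite -[u]liftK -projZ scale1r. Qed.

Lemma scaleDr : right_distributive scale +%R.
Proof.
move=> a u v; rewrite -[u]liftK -[v]liftK.
by rewrite -projD -!projZ -projD scalerDr.
Qed.

Lemma scaleDl u : {morph scale^~ u : a b / a + b}.
Proof. by move=> a b; rewrite -[u]liftK -!projZ -projD scalerDl. Qed.

Lemma scaleAl a u v : scale a (mul u v) = mul (scale a u) v.
Proof.
rewrite -[u]liftK -[v]liftK.
by rewrite -projM -!projZ -projM scalerAl.
Qed.

End PrincipalQuotient.
Module Exports. HB.reexport. End Exports.
End PrincipalQuotient.
Export PrincipalQuotient.Exports.

Module QPlane.
Import monalg PrincipalQuotient.
Section QPlane.
Variables (K : fieldType) (q : K).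

(* Words in the letters [false] (for x) and [true] (for y). *)
Definition free : lalgType K := {malg K[{fmonom bool}]}.
Definition free_x : free := << fmu false >>.
Definition free_y : free := << fmu true >>.
Definition relator : free := free_x * free_y - q^-1 *: (free_y * free_x).

Lemma mcoeff1M (u v : free) :
  (u * v : {malg K[{fmonom bool}]})@_mone = u@_mone * v@_mone.
Proof. by have [+ _] := @mcoeff1g_is_multiplicative {fmonom bool} K; apply. Qed.

Lemma one_notin_ideal : 1 \notin ideal_gen relator.
Proof.
apply/asboolP => /(_ (fun g => g@_mone = 0)) h.
have : (1 : {malg K[{fmonom bool}]})@_mone = 0.
  apply: h.
    split=> [|u v hu hv|a u hu|u a hu]; first exact: mcoeff0.
    - by rewrite mcoeffB hu hv subr0.
    - by rewrite mcoeff1M hu mulr0.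
    - by rewrite mcoeff1M hu mul0r.
  have m0 b : (<< fmu b >> : {malg K[{fmonom bool}]})@_mone = 0.
    by rewrite mcoeffU fm1_eq1.
  have xy0 : (free_x * free_y)@_mone = 0.
    by rewrite mcoeff1M (m0 false) mul0r.
  have yx0 : (free_y * free_x)@_mone = 0.
    by rewrite mcoeff1M (m0 true) mul0r.
  rewrite /relator; move: (free_x * free_y) (free_y * free_x) xy0 yx0.
  by move=> u v hu hv; rewrite mcoeffB mcoeffZ hu hv mulr0 subr0.
by rewrite mcoeff1 eqxx => /eqP; rewrite oner_eq0.
Qed.

Definition quantum_plane : Type := quot relator.

#[export]
HB.instance Definition _ := GRing.Zmodule.on quantum_plane.
#[export]
HB.instance Definition _ := GRing.Zmodule_isNzRing.Build quantum_plane
  (@mulA _ _ relator) (@mul1 _ _ relator) (@mulr1 _ _ relator)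
  (@mulDl _ _ relator) (@mulDr _ _ relator) (one_neq0 one_notin_ideal).
#[export]
HB.instance Definition _ := GRing.Zmodule_isLmodule.Build K quantum_plane
  (@scaleA _ _ relator) (@scale1 _ _ relator) (@scaleDr _ _ relator)
  (@scaleDl _ _ relator).
#[export]
HB.instance Definition _ := GRing.Lmodule_isLalgebra.Build K quantum_plane
  (@scaleAl _ _ relator).

Definition qx : quantum_plane := proj relator free_x.
Definition qy : quantum_plane := proj relator free_y.

Lemma qxy : qx * qy = q^-1 *: (qy * qx).
Proof.
rewrite [LHS](esym (projM _ _ _)).
rewrite [qy * qx](esym (projM _ _ _)) [RHS](esym (projZ _ _ _)).
exact/projE/ideal_gen_id.
Qed.

End QPlane.

Module Exports. HB.reexport. End Exports.
End QPlane.
Export QPlane.Exports.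
Notation quantum_plane := QPlane.quantum_plane.
Notation qx := QPlane.qx.
Notation qy := QPlane.qy.

From mathcomp Require Import all_classical all_reals all_analysis.
From mathcomp Require Import complex.
Import numFieldNormedType.Exports.

Local Open Scope classical_set_scope.
Local Open Scope ring_scope.

Section LocallyConvex.
Variable K : numFieldType.

Definition seminorm (E : lmodType K) (p : E -> K) : Prop :=
  [/\ forall x, 0 <= p x, forall x y, p (x + y) <= p x + p y
    & forall k x, p (k *: x) = `|k| * p x].

Definition defines_topology (E : tvsType K) (P : set (E -> K)) : Prop :=
  forall U : set E, nbhs 0 U <->
    exists (F : set (E -> K)) (e : K), [/\ F `<=` P, finite_set F, 0 < e
      & [set x | forall p, F p -> p x < e] `<=` U].

(* The uniform structure carried by a [tvsType] is only required to induce the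
   topology, so completeness is stated for the translation-invariant one. *)
Definition tvs_complete (E : tvsType K) : Prop :=
  forall F : set_system E, ProperFilter F ->
    (forall U : set E, nbhs 0 U ->
       exists2 V, F V & forall x y, V x -> V y -> U (x - y)) ->
    exists l : E, F --> l.

Definition complete_lcs (E : tvsType K) : Prop :=
  hausdorff_space E /\ tvs_complete E.

Definition frechet (E : tvsType K) : Prop :=
  complete_lcs E /\
  exists P : set (E -> K),
    [/\ countable P, P `<=` @seminorm E & defines_topology P].

Definition continuous_linear (E F : tvsType K) (f : E -> F) : Prop :=
  linear f /\ continuous f.

End LocallyConvex.

#[short(type="tvsAlgType")]
HB.structure Definition TvsAlgebra (K : numFieldType) :=
  {A of Tvs K A & GRing.Algebra K A}.

Section ArensMichael.
Variable K : numFieldType.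

Definition arens_michael (A : tvsAlgType K) : Prop :=
  complete_lcs A /\
  exists P : set (A -> K),
    [/\ P `<=` @seminorm K A,
        forall p, P p -> forall a b, p (a * b) <= p a * p b
      & defines_topology P].

Definition arens_michael_envelope (P : lalgType K) (A : tvsAlgType K)
    (w : {lrmorphism P -> A}) : Prop :=
  arens_michael A /\
  forall (B : tvsAlgType K) (f : {lrmorphism P -> B}), arens_michael B ->
    exists g : {lrmorphism A -> B},
      [/\ continuous g, forall u, g (w u) = f u
        & forall g' : {lrmorphism A -> B}, continuous g' ->
            (forall u, g' (w u) = f u) -> g' =1 g].

End ArensMichael.

Section FrechetModules.
Variables (K : numFieldType) (A : tvsAlgType K).

Record leftFrechetModule := LeftFrechetModule {
  lmod_space :> tvsType K;
  lact : A -> lmod_space -> lmod_space;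
  lmod_frechet : frechet lmod_space;
  lact_linearl : forall v, linear (lact^~ v);
  lact_linearr : forall a, linear (lact a);
  lact1 : forall v, lact 1 v = v;
  lactM : forall a b v, lact (a * b) v = lact a (lact b v);
  lact_continuous : continuous (fun z : A * lmod_space => lact z.1 z.2)
}.

Record rightFrechetModule := RightFrechetModule {
  rmod_space :> tvsType K;
  ract : rmod_space -> A -> rmod_space;
  rmod_frechet : frechet rmod_space;
  ract_linearl : forall a, linear (ract^~ a);
  ract_linearr : forall v, linear (ract v);
  ract1 : forall v, ract v 1 = v;
  ractM : forall v a b, ract v (a * b) = ract (ract v a) b;
  ract_continuous : continuous (fun z : rmod_space * A => ract z.1 z.2)
}.

Definition module_map (M N : rightFrechetModule) (f : M -> N) : Prop :=
  continuous_linear f /\ forall v a, f (ract v a) = ract (f v) a.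

Definition admissible_epi (M N : rightFrechetModule) (f : M -> N) : Prop :=
  module_map f /\
  exists2 s : N -> M, continuous_linear s & forall v, f (s v) = v.

Definition projective (P : rightFrechetModule) : Prop :=
  forall (M N : rightFrechetModule) (f : M -> N) (g : P -> N),
    admissible_epi f -> module_map g ->
    exists2 h : P -> M, module_map h & forall v, f (h v) = g v.

(* Admissible: split by a contracting homotopy of continuous linear maps. *)
Definition admissible_resolution (Y : rightFrechetModule)
    (P : nat -> rightFrechetModule)
    (d : forall n, P n.+1 -> P n) (e : P 0 -> Y) : Prop :=
  [/\ module_map e, forall n, module_map (d n),
      forall v, e (d 0 v) = 0, forall n v, d n (d n.+1 v) = 0
    & exists (s : Y -> P 0) (h : forall n, P n -> P n.+1),
      [/\ continuous_linear s, forall n, continuous_linear (h n),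
          forall y, e (s y) = y,
          forall v, d 0 (h 0 v) + s (e v) = v
        & forall n v, d n.+1 (h n.+1 v) + h n (d n v) = v]].

Definition projective_resolution (Y : rightFrechetModule)
    (P : nat -> rightFrechetModule)
    (d : forall n, P n.+1 -> P n) (e : P 0 -> Y) : Prop :=
  (forall n, projective (P n)) /\ admissible_resolution d e.

Definition balanced (Y : rightFrechetModule) (X : leftFrechetModule)
    (E : tvsType K) (b : Y -> X -> E) : Prop :=
  [/\ forall x, linear (b^~ x), forall y, linear (b y),
      continuous (fun z : Y * X => b z.1 z.2)
    & forall y a x, b (ract y a) x = b y (lact a x)].

(* [T] is the completed projective tensor product of [Y] and [X] over [A],
   with universal balanced map [t]. *)
Definition tensor_product (Y : rightFrechetModule) (X : leftFrechetModule)
    (T : tvsType K) (t : Y -> X -> T) : Prop :=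
  [/\ frechet T, balanced t
    & forall (E : tvsType K) (b : Y -> X -> E), complete_lcs E -> balanced b ->
        exists f : T -> E,
          [/\ continuous_linear f, forall y x, f (t y x) = b y x
            & forall f' : T -> E, continuous_linear f' ->
                (forall y x, f' (t y x) = b y x) -> f' =1 f]].

Definition homology_vanishes (T : nat -> tvsType K)
    (D : forall n, T n.+1 -> T n) (k : nat) : Prop :=
  match k with
  | 0 => range (D 0) = [set: T 0]
  | j.+1 => [set t : T j.+1 | D j t = 0] = range (D j.+1)
  end.

(* Vanishing of Tor_k(Y, X), the k-th homology of P tensored with X for a
   projective resolution P of the right module Y. The homology depends neither
   on P nor on the models T n of the tensor products, hence the universal
   quantification; the bar resolution shows that P and T exist when A is
   Frechet. *)
Definition Tor_vanishes (Y : rightFrechetModule) (X : leftFrechetModule)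
    (k : nat) : Prop :=
  forall (P : nat -> rightFrechetModule) (d : forall n, P n.+1 -> P n)
    (e : P 0 -> Y), projective_resolution d e ->
  forall (T : nat -> tvsType K) (t : forall n, P n -> X -> T n)
    (D : forall n, T n.+1 -> T n),
    (forall n, tensor_product (t n)) ->
    (forall n, continuous_linear (D n)) ->
    (forall n p x, D n (t n.+1 p x) = t n (d n p) x) ->
    homology_vanishes D k.

End FrechetModules.

Section ComplexComplete.
Variable R : realType.
Local Notation C := R[i].
Local Open Scope complex_scope.

Local Notation Re := (@complex.Re R).
Local Notation Im := (@complex.Im R).

Lemma normc_ReIm (z : C) :
  [/\ `|Re z|%:C <= `|z|, `|Im z|%:C <= `|z|
    & `|z| <= (`|Re z| + `|Im z|)%:C].
Proof.
rewrite normc_def !lecR; split.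
- by rewrite -sqrtr_sqr ler_wsqrtr// lerDl sqr_ge0.
- by rewrite -sqrtr_sqr ler_wsqrtr// lerDr sqr_ge0.
- have s0 : 0 <= `|Re z| + `|Im z| by rewrite addr_ge0.
  rewrite -(ger0_norm s0) -(sqrtr_sqr (_ + _)) ler_wsqrtr// sqrrD.
  rewrite !real_normK ?num_real// addrAC lerDl mulrn_wge0//.
Qed.

Lemma complex_complete : tvs_complete (C^o : tvsType C).
Proof.
move=> F FF cF.
have cF' (e : R) : 0 < e -> exists2 V : set C, F V &
    forall x y, V x -> V y -> `|x - y| < e%:C.
  move=> e0; have [|V FV h] := cF (ball (0 : C^o) (e%:C : C)).
    by apply: nbhsx_ballx; rewrite ltcR.
  exists V => // x y Vx Vy; have := h x y Vx Vy.
  by rewrite -ball_normE/= sub0r normrN.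
have cvgp (g : C -> R) : (forall x y, g (x - y) = g x - g y) ->
    (forall z, `|g z|%:C <= `|z|) -> cvg (g @ F).
  move=> gB gn; apply/cauchy_cvgP/cauchyP => e e0.
  have [V FV hV] := cF' _ e0; have [v Vv] := filter_ex FV.
  exists (g v); rewrite /nbhs/=; apply: filterS FV => x Vx.
  rewrite -ball_normE/= -gB -ltcR; exact: le_lt_trans (gn _) (hV _ _ _ _).
have /cvg_ex[/= a Fa] : cvg (Re @ F).
  apply: cvgp => [[? ?] [? ?]//|z]; by case: (normc_ReIm z).
have /cvg_ex[/= b Fb] : cvg (Im @ F).
  apply: cvgp => [[? ?] [? ?]//|z]; by case: (normc_ReIm z).
exists (a +i* b); apply/cvgrPdist_lt => /= e e0.
have eE : e = (Re e)%:C.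
  by move: e0; rewrite ltcE => /andP[/eqP/= h _]; rewrite [LHS]complexE h mulr0 addr0.
have e2 : 0 < Re e / 2 by move: e0; rewrite eE ltcR => ?; rewrite divr_gt0.
move/cvgrPdist_lt : Fa => /(_ _ e2) Fa.
move/cvgrPdist_lt : Fb => /(_ _ e2) Fb.
rewrite near_map in Fa; rewrite near_map in Fb.
near=> z.
have [_ _ /le_lt_trans] := normc_ReIm (a +i* b - z); apply.
rewrite eE [Re e]splitr ltcR.
have -> : Re (a +i* b - z) = a - Re z by case: (z).
have -> : Im (a +i* b - z) = b - Im z by case: (z).
by apply: ltrD; near: z.
Unshelve. all: by end_near. Qed.
End ComplexComplete.

Section ComplexNumbers.
Variable R : realType.
Local Notation C := R[i].

Lemma complex_frechet : frechet (C^o : tvsType C).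
Proof.
split; first by split; [exact: norm_hausdorff|exact: complex_complete].
exists [set Num.norm : C^o -> C]; split; first exact: countable1.
  move=> p ->; split; [exact: normr_ge0|exact: ler_normD|exact: normrM].
move=> U; split.
  move=> /nbhs_ballP[e /= e0 eU].
  exists [set Num.norm : C^o -> C], e; split=> [p ->//||//|]; first exact: finite_set1.
  by move=> x /(_ _ erefl) xe; apply: eU; rewrite -ball_normE/= sub0r normrN.
move=> [F [e [F1 _ e0 FU]]]; apply/nbhs_ballP; exists e => //= x.
by rewrite -ball_normE/= sub0r normrN => xe; apply: FU => p /F1 ->.
Qed.

Section CharacterModule.
Variables (A : tvsAlgType C) (chi : {lrmorphism A -> C^o}).
Hypothesis chi_cont : continuous chi.

Let act (v : C^o) (a : A) : C^o := v * chi a.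

Let act_linearl a : linear (act^~ a).
Proof. by move=> k u v; rewrite /act mulrDl -scalerAl. Qed.

Let act_linearr v : linear (act v).
Proof. by move=> k a b; rewrite /act linearP mulrDr -scalerAr. Qed.

Let act1 v : act v 1 = v.
Proof. by rewrite /act rmorph1 mulr1. Qed.

Let actM v a b : act v (a * b) = act (act v a) b.
Proof. by rewrite /act rmorphM mulrA. Qed.

Let act_continuous : continuous (fun z : C^o * A => act z.1 z.2).
Proof.
move=> z; apply: (@continuous_comp _ _ _ (fun z => (z.1, chi z.2) : C^o * C^o)
  (fun z => z.1 *: z.2)); last exact: scale_continuous.
apply: (cvg_pair (F := nbhs z) (G := nbhs z.1) (H := nbhs (chi z.2))).
  exact: cvg_fst.
by apply: continuous_comp; [exact: cvg_snd|exact: chi_cont].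
Qed.

Definition character_module : rightFrechetModule A :=
  RightFrechetModule complex_frechet act_linearl act_linearr act1 actM
    act_continuous.

End CharacterModule.

Definition Cxy : set (C * C) :=
  ([set: C] `*` [set 0]) `|` ([set 0] `*` [set: C]).

Definition koszul_d0 (q : C) (X : lmodType C) (T S : X -> X) (g : C * C)
    (v : X) : X * X :=
  (g.2 *: v - q *: S v, T v - (q * g.1) *: v).

Definition koszul_d1 (X : lmodType C) (T S : X -> X) (g : C * C)
    (z : X * X) : X :=
  (T z.1 - g.1 *: z.1) + (S z.2 - g.2 *: z.2).

Definition koszul_exact (q : C) (X : lmodType C) (T S : X -> X) (g : C * C) :
    Prop :=
  [/\ [set v | koszul_d0 q T S g v = 0] = [set 0],
      [set z | koszul_d1 T S g z = 0] = range (koszul_d0 q T S g)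
    & range (koszul_d1 T S g) = [set: X]].

Definition joint_spectrum (q : C) (X : lmodType C) (T S : X -> X) :
    set (C * C) :=
  [set g | Cxy g /\ ~ koszul_exact q T S g].

(* The point [g] is identified with the continuous character [chi] such that
   (chi x, chi y) = g, which is unique by the universal property of [w]. *)
Definition resolvent_set (q : C) (A : tvsAlgType C)
    (w : {lrmorphism quantum_plane q -> A}) (X : leftFrechetModule A) :
    set (C * C) :=
  [set g | Cxy g /\
    exists (chi : {lrmorphism A -> C^o}) (chi_cont : continuous chi),
      [/\ chi (w (qx q)) = g.1, chi (w (qy q)) = g.2
        & forall k, Tor_vanishes (character_module chi_cont) X k]].

End ComplexNumbers.

(* Main.v *)
Require Import Defs.
From HB Require Import structures.
From mathcomp Require Import all_boot all_order all_algebra.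
From mathcomp Require Import all_classical all_reals all_analysis.
From mathcomp Require Import complex.
From mathcomp Require Import ring.
From mathcomp Require monalg.

Set Implicit Arguments.
Unset Strict Implicit.
Unset Printing Implicit Defensive.

Import Order.TTheory GRing.Theory Num.Theory.
Import numFieldNormedType.Exports.

Local Open Scope classical_set_scope.
Local Open Scope ring_scope.

(** Write [A] for the Arens-Michael envelope, [x] and [y] for its generators and
    [chi] for the character at [(l, m)], where [l m = 0]. As in Taylor's theory
    of commuting tuples, Tor is computed by a Koszul complex: the sequence of
    free right modules

      0 -> A -> A (+) A -> A -> C(l, m) -> 0,
      a |-> ((m - q y) a, (x - q l) a),   (a, b) |-> (x - l) a + (y - m) b

    is an admissible projective resolution [koszul_resolution], and it becomes
    the complex of the pair [(T, S)] after tensoring with [X] over [A], because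
    [A (x) X = X]. Hence exactness of that complex is the vanishing of Tor read
    on one resolution and one choice of tensor products. The comparison theorem
    [Tor_vanishes_resolution] carries the vanishing over to all the others. To
    lift along a differential [f], which is not surjective, one uses that a
    splitting [f s f = f] makes its image the kernel of [id - f s], a Frechet
    module again [projective_lift].

    The analytic content is that the sequence splits by continuous linear maps
    and that [A] is a Frechet space. Both are drawn from the universal property
    alone, applied to well chosen algebras, without power series.

    - A subalgebra through [x] and [y] that is complete for a finer topology is
      all of [A] with its own topology [finer_subalgebra_full]. With the induced
      topology this says that [x] and [y] generate a dense subalgebra. With
      the suprema of the submultiplicative seminorms bounded by [n] on the
      generators it says that countably many seminorms define the topology of
      [A], see [q_universal_frechet].

    - A homomorphism from [A] to upper triangular matrices over [A] is a twisted
      derivation [twisted_derivation_ex]. For [m = 0], let [p] be the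
      endomorphism of [A] that fixes [x] and kills [y]. The difference quotients
      [u], [v] in [a - p a = y v(a)] and [p a - chi a = (x - l) u(a)] are twisted
      derivations, hence exist and are continuous, and they contract the Koszul
      complex [koszul_splitting_axis]. The axis [l = 0] follows by exchanging
      [x] with [y] and [q] with [q^-1]. *)

(** * Homomorphisms out of the quantum plane *)

Lemma lrmorphism_ex (K : pzRingType) (A B : lalgType K) (f : A -> B) :
  linear f -> monoid_morphism f -> exists g : {lrmorphism A -> B}, g =1 f.
Proof.
move=> lf mf.
pose fl := GRing.isLinear.Build K A B *:%R f lf.
pose fm := GRing.isMonoidMorphism.Build A B f mf.
pose g : {lrmorphism A -> B} := HB.pack_for {lrmorphism A -> B} f fl fm.
by exists g.
Qed.

Module QPlaneUniversal.
Import -(notations) monalg.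
Import PrincipalQuotient QPlane.

Section Hom.
Variables (K : fieldType) (q : K) (B : algType K) (X Y : B).
Hypothesis XY : X * Y = q^-1 *: (Y * X).

Definition word (m : fmonom bool) : B :=
  \prod_(b <- fmonom_val m) (if b then Y else X).

Lemma word_mmorphism : mmorphism word.
Proof.
split; last by rewrite /word fm1 big_nil.
by move=> u v; rewrite /word fmM big_cat.
Qed.

HB.instance Definition _ := isMultiplicative.Build _ _ word word_mmorphism.

Definition free_hom (g : free K) : B := mmap (in_alg B) word g.

Lemma free_hom_multiplicative : multiplicative (free_hom : free K -> B).
Proof.
apply: commr_mmap_is_multiplicative => g m m'.
by rewrite /GRing.comm /= mulr_algr mulr_algl.
Qed.

Lemma free_homX : free_hom (free_x K) = X.
Proof.
by rewrite /free_hom/free_x mmapU /= scale1r mul1r /word fmU big_seq1.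
Qed.

Lemma free_homY : free_hom (free_y K) = Y.
Proof.
by rewrite /free_hom/free_y mmapU /= scale1r mul1r /word fmU big_seq1.
Qed.

Lemma free_homM (g h : free K) : free_hom (g * h) = free_hom g * free_hom h.
Proof. by have [+ _] := free_hom_multiplicative; apply. Qed.

Lemma free_homB (g h : free K) : free_hom (g - h) = free_hom g - free_hom h.
Proof. exact: mmapB. Qed.

Lemma free_homD (g h : free K) : free_hom (g + h) = free_hom g + free_hom h.
Proof. exact: mmapD. Qed.

Lemma free_homZ k (g : free K) : free_hom (k *: g) = k *: free_hom g.
Proof.
rewrite /free_hom (_ : mmap _ _ _ = in_alg B k * mmap (in_alg B) word g).
  by rewrite /= -scalerAl mul1r.
exact: mmapZ.
Qed.

Lemma free_hom1 : free_hom 1 = 1.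
Proof. by have [_] := free_hom_multiplicative. Qed.

Lemma free_hom_ideal (g : free K) : g \in ideal_gen (relator q) -> free_hom g = 0.
Proof.
move=> /asboolP /(_ (fun h => free_hom h = 0)); apply.
  split=> [|u v hu hv|a u hu|a u hu].
  - by rewrite -(subrr 0) free_homB subrr.
  - by rewrite free_homB hu hv subrr.
  - by rewrite free_homM hu mulr0.
  - by rewrite free_homM hu mul0r.
have xy : free_hom (free_x K * free_y K) = X * Y.
  by rewrite free_homM free_homX free_homY.
have yx : free_hom (free_y K * free_x K) = Y * X.
  by rewrite free_homM free_homX free_homY.
rewrite /relator; move: (free_x K * free_y K) (free_y K * free_x K) xy yx.
by move=> u v uXY vYX; rewrite free_homB free_homZ uXY vYX XY subrr.
Qed.

Lemma free_hom_lift (g : free K) : free_hom (lift (proj (relator q) g)) = free_hom g.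
Proof.
apply/eqP; rewrite -subr_eq0 -free_homB; apply/eqP/free_hom_ideal.
by apply/projE; rewrite liftK.
Qed.

(** A word is sent to the product of the images of its letters; this evaluation
    of the free algebra kills the relator, so it descends to the quotient. *)
Lemma quantum_plane_hom :
  exists f : {lrmorphism quantum_plane q -> B}, f (qx q) = X /\ f (qy q) = Y.
Proof.
pose f0 (u : quantum_plane q) := free_hom (lift u).
have f0proj g : f0 (proj (relator q) g) = free_hom g by exact: free_hom_lift.
have [|| f fE] := @lrmorphism_ex K (quantum_plane q) B f0.
- move=> k u v; rewrite -(liftK u) -(liftK v).
  have -> : k *: (proj (relator q) (lift u) : quantum_plane q)
      + proj (relator q) (lift v) = proj (relator q) (k *: lift u + lift v).
    by rewrite projD projZ.
  by rewrite !f0proj free_homD free_homZ.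
- split; first by rewrite [LHS]f0proj free_hom1.
  move=> u v; rewrite -(liftK u) -(liftK v).
  have -> : (proj (relator q) (lift u) : quantum_plane q)
      * proj (relator q) (lift v) = proj (relator q) (lift u * lift v).
    by rewrite projM.
  by rewrite !f0proj free_homM.
exists f; rewrite !fE; split.
  by rewrite -[LHS]/(f0 (proj _ _)) f0proj free_homX.
by rewrite -[LHS]/(f0 (proj _ _)) f0proj free_homY.
Qed.

End Hom.

Section Ext.
Variables (K : fieldType) (q : K) (B : lalgType K).

(** The words span the free algebra, and a word is a product of letters. *)
Lemma quantum_plane_ext (f g : {lrmorphism quantum_plane q -> B}) :
  f (qx q) = g (qx q) -> f (qy q) = g (qy q) -> f =1 g.
Proof.
move=> fgx fgy u; rewrite -(liftK u).
pose p (v : free K) : quantum_plane q := proj (relator q) v.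
have pD v w : p (v + w) = p v + p w by exact: projD.
have pM v w : p (v * w) = p v * p w by exact: projM.
have pZ k v : p (k *: v) = k *: p v by exact: projZ.
rewrite -/(p (lift u)); move: (lift u) => {}u.
rewrite [u]monalgE; elim/big_ind: _.
- have -> : p 0 = 0 by exact: proj0.
  by rewrite !linear0.
- by move=> v w fgv fgw; rewrite pD !rmorphD /= fgv fgw.
move=> m _; move: (mcoeff m u) => c.
have -> : mkmalgU m c = c *: (mkmalgU m 1 : free K).
  apply/malgP => k; rewrite mcoeffZ mcoeffU [X in _ * X]mcoeffU.
  by rewrite mulrnAr GRing.mulr1.
rewrite pZ !linearZ /=; congr (_ *: _).
case: m => s; elim: s => [|b s IH].
  have -> : mkmalgU (FMonom [::]) 1 = 1 :> free K by rewrite -fmoneE.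
  by rewrite !rmorph1.
have -> : mkmalgU (FMonom (b :: s)) 1 =
    mkmalgU (fmu b) 1 * mkmalgU (FMonom s) 1 :> free K.
  by rewrite malgM_def fgmulUU GRing.mulr1; congr (mkmalgU _ 1);
    rewrite /= fmuE [RHS]fmmulE.
rewrite pM !rmorphM /= IH; congr (_ * _).
by case: b.
Qed.

End Ext.

End QPlaneUniversal.

(** * Topologies defined by seminorms *)

Lemma filter_finite_forall (I : choiceType) (T : Type) (G : set_system T) (F : set I)
    (B : I -> set T) : Filter G -> finite_set F ->
  (forall i, F i -> G (B i)) -> G [set x | forall i, F i -> B i x].
Proof.
move=> GF /finite_seqP[s ->] h.
elim: s h => [|i s IH] h; first by apply: filterS filterT => x _ j.
have h1 := h i (mem_head _ _).
have h2 : G [set x | forall j, j \in s -> B j x].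
  by apply: IH => j js; apply: h; rewrite /= inE js orbT.
apply: filterS (filterI h1 h2) => x [xi xs] j /=.
by rewrite inE => /predU1P[->//|/xs].
Qed.

Lemma pos_lb2 (K : numDomainType) (a b : K) : 0 < a -> 0 < b ->
  exists e : K, [/\ 0 < e, e <= a & e <= b].
Proof.
move=> a0 b0; case: (real_leP (gtr0_real a0) (gtr0_real b0)) => h.
  by exists a.
by exists b; split=> //; exact: ltW.
Qed.

Section Seminorm.
Variables (K : numFieldType) (E : lmodType K) (p : E -> K).
Hypothesis sp : seminorm p.

Lemma seminorm_ge0 x : 0 <= p x. Proof. by case: sp. Qed.
Lemma seminormD x y : p (x + y) <= p x + p y. Proof. by case: sp. Qed.
Lemma seminormZ k x : p (k *: x) = `|k| * p x. Proof. by case: sp. Qed.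
Lemma seminorm0 : p 0 = 0.
Proof. by rewrite -(scale0r 0) seminormZ normr0 mul0r. Qed.
Lemma seminormN x : p (- x) = p x.
Proof. by rewrite -scaleN1r seminormZ normrN1 mul1r. Qed.
Lemma seminorm_distC x y : p (x - y) = p (y - x).
Proof. by rewrite -seminormN opprB. Qed.
Lemma seminorm_tri z x y : p (x - y) <= p (x - z) + p (z - y).
Proof. by rewrite (le_trans _ (seminormD _ _))// addrA subrK. Qed.
End Seminorm.

(** A copy of [V] that carries the locally convex topology of [P]; the proof [sP]
    is a parameter so that this structure can be inferred from the type. *)
Definition seminormed (K : numFieldType) (V : lmodType K) (P : set (V -> K))
  (sP : P `<=` @seminorm K V) : Type := V.

Section Seminormed.
Variables (K : numFieldType) (V : lmodType K) (P : set (V -> K)).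
Hypothesis sP : P `<=` @seminorm K V.
Local Notation E := (seminormed sP).

HB.instance Definition _ := GRing.Lmodule.on E.

Definition seminormed_nbhs (x : E) : set_system E := [set U : set E |
  exists (F : set (V -> K)) (e : K), [/\ F `<=` P, finite_set F, 0 < e
    & [set y | forall p, F p -> p (y - x) < e] `<=` U]].

HB.instance Definition _ := hasNbhs.Build E seminormed_nbhs.

Let nbhs_filt (x : E) : ProperFilter (nbhs x).
Proof.
split.
  move=> [F [e [FP _ e0 /(_ x)]]]; apply=> p /FP/sP sp /=.
  by rewrite subrr seminorm0.
split.
- by exists set0, 1; split=> //; exact: ltr01.
- move=> U U' [F [e [FP fF e0 FU]]] [F' [e' [FP' fF' e0' FU']]].
  have [d [d0 de de']] := pos_lb2 e0 e0'.
  exists (F `|` F'), d; split=> //.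
  + by move=> p [/FP|/FP'].
  + by rewrite finite_setU.
  + move=> y /= h; split; [apply: FU|apply: FU'] => p Fp.
      by apply: lt_le_trans de; apply: h; left.
    by apply: lt_le_trans de'; apply: h; right.
- move=> U U' UU' [F [e [FP fF e0 FU]]]; exists F, e; split=> //.
  exact: subset_trans FU UU'.
Qed.

Let nbhs_sing (x : E) (A : set E) : nbhs x A -> A x.
Proof.
by move=> [F [e [FP _ e0]]]; apply=> p /FP/sP sp /=; rewrite subrr seminorm0.
Qed.

Let nbhs_nb (x : E) (A : set E) : nbhs x A -> nbhs x (nbhs^~ A).
Proof.
move=> [F [e [FP fF e0 FA]]].
have e20 : 0 < e / 2 by rewrite divr_gt0.
exists F, (e / 2); split=> // y /= hy.
exists F, (e / 2); split=> // z /= hz; apply: FA => p Fp /=.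
have sp : seminorm p := sP (FP _ Fp).
rewrite (le_lt_trans (seminorm_tri sp y z x))// [e]splitr.
by apply: ltrD; [exact: hz|exact: hy].
Qed.

HB.instance Definition _ :=
  Nbhs_isNbhsTopological.Build E nbhs_filt nbhs_sing nbhs_nb.

Lemma seminormed_balls (F : set (V -> K)) (x : E) (e : K) :
  F `<=` P -> finite_set F -> 0 < e ->
  nbhs x [set y : E | forall p, F p -> p (y - x) < e].
Proof. by move=> FP fF e0; exists F, e; split=> // y. Qed.

Lemma seminormed_ball (p : V -> K) (x : E) (e : K) : P p -> 0 < e ->
  nbhs x [set y : E | p (y - x) < e].
Proof.
move=> Pp e0; exists [set p], e; split=> //.
- by move=> _ ->.
- by move=> y /=; apply.
Qed.

Let add_cont : continuous (fun x : E * E => x.1 + x.2).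
Proof.
move=> [x y] /= U [F [e [FP fF e0 FU]]].
have e20 : 0 < e / 2 by rewrite divr_gt0.
exists ([set z | forall p, F p -> p (z - x) < e / 2],
        [set z | forall p, F p -> p (z - y) < e / 2]).
  by split; exact: seminormed_balls.
move=> [z z'] [/= hz hz']; apply: FU => p Fp /=.
have sp : seminorm p := sP (FP _ Fp).
rewrite opprD addrACA (le_lt_trans (seminormD sp _ _))// [e]splitr.
by apply: ltrD; [exact: hz|exact: hz'].
Qed.

Let scale_cont : continuous (fun z : K^o * E => z.1 *: z.2).
Proof.
move=> [k x] /= U [F [e [FP fF e0 FU]]].
suff : nbhs (k, x) [set z : K^o * E | forall p, F p ->
    p ((z.1 : K) *: z.2 - k *: x) < e] by apply: filterS => z; exact: FU.
apply: filter_finite_forall => // p Fp.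
have Pp := FP _ Fp; have sp := sP Pp.
have px := seminorm_ge0 sp x.
have k1 : 0 < `|k| + 1 by rewrite ltr_wpDl.
have e20 : 0 < e / 2 by rewrite divr_gt0.
exists (ball (k : K^o) 1 `&` ball (k : K^o) (e / 2 / (p x + 1)),
   [set y : E | p (y - x) < e / 2 / (`|k| + 1)]).
  split.
    apply: filterI; apply: nbhsx_ballx => //.
    by rewrite divr_gt0// ltr_wpDl.
  by apply: seminormed_ball => //; rewrite divr_gt0.
move=> [l y] [[]] /=; rewrite -!ball_normE /= => kl1 kl2 yx.
have -> : l *: (y : V) - k *: (x : V) = l *: (y - x) + (l - k) *: x.
  by rewrite scalerBr scalerBl addrA subrK.
rewrite (le_lt_trans (seminormD sp _ _))// [e]splitr !(seminormZ sp) ltr_leD//.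
  rewrite (@le_lt_trans _ _ ((`|k| + 1) * p (y - x)))//.
    rewrite ler_wpM2r ?seminorm_ge0// -lerBlDl (le_trans _ (ltW kl1))//.
    by rewrite distrC lerB_dist.
  by rewrite mulrC -ltr_pdivlMr.
rewrite distrC (le_trans (ler_wpM2r px (ltW kl2)))//.
have px1 : 0 < p x + 1 by rewrite ltr_wpDl.
by rewrite mulrAC ler_pdivrMr// ler_pM2l// lerDl.
Qed.

Let loc_convex :
  exists2 B : set_system E, (forall b, b \in B -> convex_set b) & basis B.
Proof.
exists [set b : set E | open b /\ convex_set b].
  by move=> b; rewrite inE => -[].
split=> [b []//|x U [F [e [FP fF e0 FU]]]].
exists [set y | forall p, F p -> p (y - x) < e]; last exact: FU.
split; last by move=> p Fp /=; rewrite subrr (seminorm0 (sP (FP _ Fp))).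
split.
  rewrite openE => y /= hy; rewrite /interior.
  suff : nbhs y [set z : E | forall p, F p -> p (z - x) < e] by [].
  apply: filter_finite_forall => // p Fp.
  have sp := sP (FP _ Fp).
  have d0 : 0 < e - p (y - x) by rewrite subr_gt0; exact: hy.
  apply: filterS (seminormed_ball y (FP _ Fp) d0) => z /= hz.
  by rewrite (le_lt_trans (seminorm_tri sp y z x))// -ltrBrDr.
apply/convex_setW => y z; rewrite !inE /= => hy hz l l0 l1.
rewrite inE /= => p Fp.
have sp := sP (FP _ Fp).
have -> : conv l y z - x = l%:num *: (y - x : V) + (1 - l%:num) *: (z - x : V).
  by rewrite !scalerBr addrACA -opprD -scalerDl [l%:num + _]addrC subrK scale1r.
rewrite (le_lt_trans (seminormD sp _ _))// !(seminormZ sp).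
rewrite (ger0_norm (ltW l0)) ger0_norm ?subr_ge0 ?ltW//.
have -> : e = l%:num * e + (1 - l%:num) * e.
  by rewrite -mulrDl addrC subrK mul1r.
apply: ltrD; first by rewrite ltr_pM2l//; exact: hy.
by rewrite ltr_pM2l ?subr_gt0//; exact: hz.
Qed.

(* The factory declares the uniform structure; the other ingredients of a
   topological vector space are added one at a time. *)
HB.instance Definition _ :=
  PreTopologicalLmod_isTvs.Build K E add_cont scale_cont loc_convex.
HB.instance Definition _ :=
  PreTopologicalNmodule_isTopologicalNmodule.Build E add_cont.
HB.instance Definition _ :=
  TopologicalNmodule_isTopologicalLmodule.Build K E scale_cont.
HB.instance Definition _ := Uniform_isTvs.Build K E loc_convex.

Lemma seminormed_topology : defines_topology (E := E) P.
Proof.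
by move=> U; split=> -[F [e [FP fF e0 FU]]]; exists F, e; split=> // x;
  [move=> h; apply: FU => p; rewrite subr0; exact: h
  |move=> h; apply: FU => p; move: (h p); rewrite subr0].
Qed.

End Seminormed.

(** * Continuous linear maps, completeness and products *)

Lemma continuous_fst_snd (E F G : topologicalType) :
  continuous (fun z : (E * F) * G => (z.1.1, z.2)).
Proof.
move=> z; apply: cvg_pair; last exact: cvg_snd.
by apply: (@continuous_comp _ _ _ fst fst); exact: cvg_fst.
Qed.

Lemma continuous_snd_snd (E F G : topologicalType) :
  continuous (fun z : (E * F) * G => (z.1.2, z.2)).
Proof.
move=> z; apply: cvg_pair; last exact: cvg_snd.
by apply: (@continuous_comp _ _ _ fst snd); [exact: cvg_fst|exact: cvg_snd].
Qed.

Lemma continuous_map_fst (E F G : topologicalType) (j : E -> F) :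
  continuous j -> continuous (fun z : E * G => (j z.1, z.2)).
Proof.
move=> jc z; apply: cvg_pair; last exact: cvg_snd.
by apply: continuous_comp; [exact: cvg_fst|exact: jc].
Qed.

Section LinearMaps.
Variable K : numFieldType.
Implicit Types E F G : tvsType K.

(** Rewriting rules for a map whose linearity is a hypothesis and not part of a
    bundled structure. *)
Lemma linear_eqs (E F : lmodType K) (f : E -> F) : linear f ->
  [/\ f 0 = 0, {morph f : x y / x + y}, {morph f : x / - x},
    {morph f : x y / x - y} & forall k, {morph f : x / k *: x}].
Proof.
move=> fl.
have f0 : f 0 = 0.
  have := fl (-1) 0 0; rewrite scaler0 addr0 => /eqP.
  by rewrite scaleN1r addNr => /eqP.
have fZ k x : f (k *: x) = k *: f x by rewrite -[k *: x]addr0 fl f0 addr0.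
have fD x y : f (x + y) = f x + f y by rewrite -[x]scale1r fl !scale1r.
have fN x : f (- x) = - f x by rewrite -scaleN1r fZ scaleN1r.
by split=> // x y; rewrite fD fN.
Qed.

Lemma nbhs_shift E (x : E) (U : set E) :
  nbhs x U <-> nbhs 0 [set z | U (x + z)].
Proof.
split=> [xU|].
  have /= := @add_continuous E (x, 0) U; rewrite addr0 => /(_ xU)[[B1 B2]/= [b1 b2]].
  move=> h; apply: filterS b2 => z Bz; apply: (h (x, z)); split=> //=.
  exact: nbhs_singleton b1.
move=> h; have := nbhsT x h; apply: filterS => _ [z Uz <-]; exact: Uz.
Qed.

Lemma nbhs_ball_seminorm E (p : E -> K) (x : E) (e : K) :
  nbhs 0 [set y | p y < e] -> nbhs x [set y | p (y - x) < e].
Proof. by rewrite nbhs_shift; apply: filterS => y /=; rewrite addrAC subrr add0r. Qed.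

Lemma linear_continuous0 E F (f : E -> F) : linear f ->
  (forall U, nbhs 0 U -> nbhs 0 (f @^-1` U)) -> continuous f.
Proof.
move=> /linear_eqs[f0 fD _ _ _] h x U /nbhs_shift /h /= fU; apply/nbhs_shift.
by apply: filterS fU => z; rewrite /= -fD.
Qed.

Lemma clin_id E : continuous_linear (@id E).
Proof. by split=> // x; exact: cvg_id. Qed.

Lemma clin_zero E F : continuous_linear (fun _ : E => 0 : F).
Proof. by split=> [k x y|x]; [rewrite scaler0 addr0|exact: cvg_cst]. Qed.

Lemma clin_comp E F G (g : F -> G) (f : E -> F) :
  continuous_linear g -> continuous_linear f ->
  continuous_linear (fun x => g (f x)).
Proof.
move=> [gl gc] [fl fc]; split=> [k x y|x]; first by rewrite fl gl.
by apply: continuous_comp; [exact: fc|exact: gc].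
Qed.

Lemma clin_add E F (f g : E -> F) : continuous_linear f ->
  continuous_linear g -> continuous_linear (fun x => f x + g x).
Proof.
move=> [fl fc] [gl gc]; split=> [k x y|x].
  by rewrite fl gl scalerDr addrACA.
apply: (@continuous_comp _ _ _ (fun x => (f x, g x)) (fun z => z.1 + z.2)).
  by apply: cvg_pair; [exact: fc|exact: gc].
exact: add_continuous.
Qed.

Lemma clin_scale E F (k : K) (f : E -> F) : continuous_linear f ->
  continuous_linear (fun x => k *: f x).
Proof.
move=> [fl fc]; split=> [l x y|x].
  by rewrite fl scalerDr !scalerA mulrC.
apply: (@continuous_comp _ _ _ (fun x => (k, f x) : K^o * F) (fun z => z.1 *: z.2)).
  by apply: (@cvg_pair _ _ _ _ (nbhs (k : K^o))); [exact: cvg_cst|exact: fc].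
exact: scale_continuous.
Qed.

Lemma clin_opp E F (f : E -> F) : continuous_linear f ->
  continuous_linear (fun x => - f x).
Proof.
move=> /(clin_scale (-1)).
by congr continuous_linear; apply/funext => x; rewrite scaleN1r.
Qed.

Lemma clin_sub E F (f g : E -> F) : continuous_linear f ->
  continuous_linear g -> continuous_linear (fun x => f x - g x).
Proof. by move=> fc /clin_opp; exact: clin_add. Qed.

Lemma clin_fst E F : continuous_linear (@fst E F).
Proof. by split=> // x; exact: cvg_fst. Qed.

Lemma clin_snd E F : continuous_linear (@snd E F).
Proof. by split=> // x; exact: cvg_snd. Qed.

Lemma clin_pair E F G (f : E -> F) (g : E -> G) : continuous_linear f ->
  continuous_linear g -> continuous_linear (fun x => (f x, g x)).
Proof.
move=> [fl fc] [gl gc]; split=> [k x y|x]; first by rewrite fl gl.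
by apply: cvg_pair; [exact: fc|exact: gc].
Qed.

End LinearMaps.

Section ClosedSets.
Variable K : numFieldType.
Implicit Types E F : tvsType K.

Lemma hausdorff_inj E F (f : E -> F) : injective f -> continuous f ->
  hausdorff_space F -> hausdorff_space E.
Proof.
move=> fi fc hF x y cxy; apply/fi/hF => A B /fc fA /fc fB.
by have [z [Az Bz]] := cxy _ _ fA fB; exists (f z).
Qed.

(** Zero sets of continuous maps are closed, in the form needed for limits of
    filters: this is how kernels inherit completeness and how identities pass
    from a dense subalgebra to the whole algebra. *)
Lemma cvg_kernel E F (f : E -> F) (G : set_system E) (l : E) :
  hausdorff_space F -> continuous f -> ProperFilter G -> G --> l ->
  G [set x | f x = 0] -> f l = 0.
Proof.
move=> hF fc GF Gl G0; apply: hF => A B /fc /Gl fA B0.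
have [x [Ax /= f0]] := filter_ex (filterI fA G0).
by exists 0; split; [rewrite -f0|exact: nbhs_singleton].
Qed.

End ClosedSets.

Section Completeness.
Variable K : numFieldType.

Definition continuous_seminorm (E : tvsType K) (p : E -> K) : Prop :=
  seminorm p /\ forall e, 0 < e -> nbhs 0 [set x | p x < e].

Lemma defines_topology_ball (E : tvsType K) (P : set (E -> K)) p :
  P `<=` @seminorm K E -> defines_topology P -> P p -> continuous_seminorm p.
Proof.
move=> sP tP Pp; split; first exact: sP.
move=> e e0; apply/tP; exists [set p], e; split=> //.
- by move=> _ ->.
- by move=> x /=; apply.
Qed.

Section SeminormedComplete.
Variables (V : lmodType K) (P : set (V -> K)) (sP : P `<=` @seminorm K V).
Variables (E : tvsType K) (i : V -> E).
Hypotheses (il : linear i) (ii : injective i) (Ecomplete : complete_lcs E).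
Hypothesis i_cont : forall U : set E, nbhs 0 U ->
  exists (F : set (V -> K)) (e : K), [/\ F `<=` P, finite_set F, 0 < e
      & [set x | forall p, F p -> p x < e] `<=` i @^-1` U].
Hypothesis P_sup : forall p, P p -> exists S : set (E -> K),
  S `<=` @continuous_seminorm E /\
  forall v e, 0 < e -> (p v <= e <-> forall s, S s -> s (i v) <= e).
Hypothesis i_lim : forall (F : set_system V) (l : E), ProperFilter F ->
  (forall p e, P p -> 0 < e ->
     exists2 B, F B & forall x y, B x -> B y -> p (x - y) < e) ->
  i @ F --> l -> exists v, i v = l.

Lemma seminormed_inj_continuous : continuous (i : seminormed sP -> E).
Proof.
apply: linear_continuous0 => // U /i_cont h.
exact/seminormed_topology.
Qed.

(** A Cauchy filter of [V] converges in [E]; a seminorm of [P] being a supremum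
    of continuous seminorms of [E], its balls are closed for the topology of
    [E], so the convergence also takes place in [V]. *)
Lemma seminormed_complete : complete_lcs (seminormed sP).
Proof.
have [hE cE] := Ecomplete; have ic := seminormed_inj_continuous.
split; first exact: (@hausdorff_inj K (seminormed sP) E i ii ic hE).
have [i0 iD iN iB iZ] := linear_eqs il.
move=> F FF cF.
have [l Fl] : exists l : E, i @ F --> l.
  apply: cE => U U0; have i0U : nbhs (0 : seminormed sP) (i @^-1` U).
    by apply: ic; rewrite [i _]i0.
  have [B FB hB] := cF _ i0U.
  exists (i @` B); first by rewrite /fmap/=; apply: filterS FB => x Bx; exists x.
  by move=> _ _ [x Bx <-] [y By <-]; rewrite -iB; exact: hB.
have cFP p e : P p -> 0 < e ->
    exists2 B, F B & forall x y, B x -> B y -> p (x - y) < e.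
  move=> Pp e0; have := @seminormed_ball _ _ _ sP p 0 e Pp e0.
  move=> /cF[B FB hB]; exists B => // x y Bx By.
  by have := hB x y Bx By; rewrite /= subr0.
have [v vl] := i_lim FF cFP Fl.
exists v => U [Q [e [QP fQ e0 QU]]]; rewrite nbhs_filterE; apply: filterS QU _.
apply: filter_finite_forall => // p /QP Pp.
have sp := sP Pp.
have e4 : 0 < e / 2 / 2 by rewrite !divr_gt0.
have [B FB hB] := cFP p (e / 2 / 2) Pp e4.
apply: (filterS _ FB) => y By /=.
suff : p (y - v) <= e / 2.
  move/le_lt_trans; apply; rewrite ltr_pdivrMr// ltr_pMr// ltr1n//.
have [S [cS pS]] := P_sup Pp; apply/pS; first by rewrite divr_gt0.
move=> s Ss; have [ss sc] := cS _ Ss.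
have Fs : F [set x | s (i x - l) < e / 2 / 2].
  exact: (Fl _ (nbhs_ball_seminorm l (sc _ e4))).
have [x [Bx /= xl]] := filter_ex (filterI FB Fs).
rewrite iB vl (le_trans (seminorm_tri ss (i x) _ _))// [e / 2]splitr.
rewrite lerD//; last exact: ltW.
by rewrite -iB; have [+ _] := pS (y - x) _ e4; apply=> //; apply/ltW/hB.
Qed.

End SeminormedComplete.
End Completeness.

Section Products.
Variable K : numFieldType.
Implicit Types E F : tvsType K.

Lemma complete_lcs_prod E F :
  complete_lcs E -> complete_lcs F -> complete_lcs (E * F : tvsType K)%type.
Proof.
move=> [hE cE] [hF cF]; split.
  move=> [x1 x2] [y1 y2] h; congr (_, _).
    apply: hE => A B xA yB.
    have [| |z [Az Bz]] := h (fst @^-1` A) (fst @^-1` B); last by exists z.1.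
      exact: (@cvg_fst _ _ (nbhs x1) (nbhs x2)).
    exact: (@cvg_fst _ _ (nbhs y1) (nbhs y2)).
  apply: hF => A B xA yB.
  have [| |z [Az Bz]] := h (snd @^-1` A) (snd @^-1` B); last by exists z.2.
    exact: (@cvg_snd _ _ (nbhs x1) (nbhs x2)).
  exact: (@cvg_snd _ _ (nbhs y1) (nbhs y2)).
move=> G GF cG.
have [l1 Gl1] : exists l : E, fst @ G --> l.
  apply: (cE (fmap fst G) (fmap_proper_filter _ GF)) => U U0.
  have [|B GB hB] := cG (fst @^-1` U).
    exact: (@cvg_fst _ _ (nbhs 0) (nbhs 0)).
  exists (fst @` B); first by apply: (@filterS _ G _ B _ _ GB) => x Bx; exists x.
  by move=> _ _ [x Bx <-] [y By <-]; exact: (hB x y).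
have [l2 Gl2] : exists l : F, snd @ G --> l.
  apply: (cF (fmap snd G) (fmap_proper_filter _ GF)) => U U0.
  have [|B GB hB] := cG (snd @^-1` U).
    exact: (@cvg_snd _ _ (nbhs 0) (nbhs 0)).
  exists (snd @` B); first by apply: (@filterS _ G _ B _ _ GB) => x Bx; exists x.
  by move=> _ _ [x Bx <-] [y By <-]; exact: (hB x y).
exists (l1, l2).
have h := @cvg_pair _ _ _ G (nbhs l1) (nbhs l2) _ _ _ _ _ Gl1 Gl2.
move=> U /h hU; rewrite nbhs_filterE; have GF' := @filter_filter _ G GF.
by apply: (@filterS _ G GF' _ U _ hU) => -[].
Qed.

Lemma defines_topology_prod E F (P : set (E -> K)) (Q : set (F -> K)) :
  P `<=` @seminorm K E -> Q `<=` @seminorm K F ->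
  defines_topology P -> defines_topology Q ->
  defines_topology (E := (E * F)%type : tvsType K)
    ([set p \o fst | p in P] `|` [set p \o snd | p in Q]).
Proof.
move=> sP sQ tP tQ U; split.
  move=> [[A B] /= [/tP[G [d [GP fG d0 GA]]] /tQ[H [e [HQ fH e0 HB]]]] ABU].
  have [c [c0 cd ce]] := pos_lb2 d0 e0.
  exists ([set p \o fst | p in G] `|` [set p \o snd | p in H]), c; split=> //.
  - by move=> _ [[p /GP Pp <-]|[p /HQ Qp <-]]; [left|right]; exists p.
  - by rewrite finite_setU; split; exact: finite_image.
  - move=> [x y] h; apply: ABU; split=> /=; [apply: GA|apply: HB] => p Fp /=.
      by apply: lt_le_trans cd; apply: (h (p \o fst)); left; exists p.
    by apply: lt_le_trans ce; apply: (h (p \o snd)); right; exists p.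
move=> [G [e [GP fG e0 GU]]]; apply: filterS GU _.
apply: filter_finite_forall => // _ /GP[[p Pp <-]|[p Pp <-]].
  have [_ /(_ e e0)] := defines_topology_ball sP tP Pp.
  by move/(@cvg_fst _ _ (nbhs 0) (nbhs (0 : F))).
have [_ /(_ e e0)] := defines_topology_ball sQ tQ Pp.
by move/(@cvg_snd _ _ (nbhs (0 : E)) (nbhs 0)).
Qed.

Lemma frechet_prod E F :
  frechet E -> frechet F -> frechet (E * F : tvsType K)%type.
Proof.
move=> [cE [P [Pc sP tP]]] [cF [Q [Qc sQ tQ]]].
split; first exact: complete_lcs_prod.
exists ([set p \o fst | p in P] `|` [set p \o snd | p in Q]); split.
- rewrite -bigcup2E; apply: bigcup_countable => // -[|[|n]] _ /=.
  + exact: sub_countable (card_image_le _ _) Pc.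
  + exact: sub_countable (card_image_le _ _) Qc.
  + exact: countable0.
- move=> _ [[p /sP[p0 pD pZ] <-]|[p /sQ[p0 pD pZ] <-]].
  + by split=> [z|z z'|k z]; [exact: p0|exact: pD|exact: pZ].
  + by split=> [z|z z'|k z]; [exact: p0|exact: pD|exact: pZ].
- exact: defines_topology_prod.
Qed.

End Products.

(** * Kernels of continuous linear maps *)

Section Kernel.
Variables (K : numFieldType) (E F : lmodType K) (k : E -> F).

(** Linearity is a phantom argument, by which the closure properties of this
    predicate are found. *)
Definition ker_pred (kl : linear k) : {pred E} := fun x => k x == 0.

Variable kl : linear k.

Lemma ker_submod_closed : GRing.submod_closed (ker_pred kl).
Proof.
have [k0 kD _ _ kZ] := linear_eqs kl.
split; first by rewrite unfold_in k0.
move=> c u v; rewrite !unfold_in => /eqP ku /eqP kv.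
by rewrite kD kZ ku kv scaler0 addr0.
Qed.

HB.instance Definition _ :=
  GRing.isSubmodClosed.Build K E (ker_pred kl) ker_submod_closed.

Record kernel := Kernel { ker_val : E; ker_valP : ker_val \in ker_pred kl }.

HB.instance Definition _ := [isSub for ker_val].
HB.instance Definition _ := [Choice of kernel by <:].
HB.instance Definition _ := [SubChoice_isSubLmodule of kernel by <:].

Lemma ker_val_linear : linear ker_val.
Proof. by move=> c u v; exact: (linearP (val : {linear kernel -> E})). Qed.

Lemma ker_val_inj : injective ker_val.
Proof. exact: val_inj. Qed.

Lemma ker_valE (x : kernel) : k (ker_val x) = 0.
Proof. by case: x => x /= /eqP. Qed.

End Kernel.

Section KernelSpace.
Variables (K : numFieldType) (E F : tvsType K) (k : E -> F).
Hypotheses (kl : linear k) (kc : continuous k) (hF : hausdorff_space F).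

Lemma kernel_seminorm (P : set (E -> K)) : P `<=` @seminorm K E ->
  [set p \o @ker_val _ _ _ _ kl | p in P] `<=` @seminorm K (kernel kl).
Proof.
move=> sP _ [p /sP[p0 pD pZ] <-].
have [_ vD _ _ vZ] := linear_eqs (@ker_val_linear _ _ _ _ kl).
split=> [z|z z'|c z]; first exact: p0.
  by have := pD (ker_val z) (ker_val z'); rewrite -vD.
by have := pZ c (ker_val z); rewrite -vZ.
Qed.

Variables (P : set (E -> K)) (sP : P `<=` @seminorm K E).
Hypotheses (tP : defines_topology P) (Pc : countable P) (cE : complete_lcs E).
Local Notation Z := (seminormed (kernel_seminorm sP)).
Local Notation val := (@ker_val _ _ _ _ kl).

Lemma kernel_basis (U : set E) : nbhs 0 U ->
  exists (F : set (kernel kl -> K)) (e : K),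
    [/\ F `<=` [set p \o val | p in P], finite_set F, 0 < e
      & [set x | forall p, F p -> p x < e] `<=` val @^-1` U].
Proof.
move=> /tP[G [e [GP fG e0 GU]]].
exists [set p \o val | p in G], e; split=> //.
- by move=> _ [p /GP Pp <-]; exists p.
- exact: finite_image.
- by move=> x h; apply: GU => p Gp; apply: (h (p \o val)); exists p.
Qed.

Lemma kernel_frechet : frechet (Z : tvsType K).
Proof.
split; last first.
  exists [set p \o val | p in P]; split.
  - exact: sub_countable (card_image_le _ _) Pc.
  - exact: kernel_seminorm.
  - exact: seminormed_topology.
apply: (@seminormed_complete _ _ _ (kernel_seminorm sP) E val) => //.
- exact: ker_val_inj.
- exact: kernel_basis.
- move=> _ [p Pp <-]; exists [set p]; split.
    by move=> _ ->; exact: defines_topology_ball tP Pp.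
  by move=> v e e0; split=> [h _ ->//|]; apply.
- move=> G l GF _ Gl.
  have kl0 : k l = 0.
    apply: (cvg_kernel hF kc (fmap_proper_filter val GF) Gl).
    by apply: (@filterS _ G _ setT) filterT => x _ /=; exact: ker_valE.
  have lk : l \in ker_pred kl by rewrite unfold_in kl0.
  by exists (Kernel lk).
Qed.

Lemma ker_val_continuous : continuous (val : Z -> E).
Proof.
apply: seminormed_inj_continuous; first exact: ker_val_linear.
exact: kernel_basis.
Qed.

(** The topology of the kernel being the induced one, continuity of a map into it
    is tested in the ambient space. *)
Lemma kernel_corestrict (T : topologicalType) (f : T -> Z) :
  continuous (fun x => val (f x)) -> continuous f.
Proof.
move=> fc x U [G [e [GP fG e0 GU]]].
apply: filterS GU _; apply: filter_finite_forall => // _ /GP[p Pp <-].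
have [_ /(_ e e0) pe] := defines_topology_ball sP tP Pp.
have h : nbhs x [set y | p (val (f y) - val (f x)) < e].
  exact: fc x _ (nbhs_ball_seminorm (val (f x)) pe).
have [_ _ _ vB _] := linear_eqs (@ker_val_linear _ _ _ _ kl).
by apply: (filterS _ h) => y; rewrite /= -vB.
Qed.

End KernelSpace.

(** * Frechet modules and projective lifting *)

Section Modules.
Variables (K : numFieldType) (A : tvsAlgType K).
Implicit Types L M N Q : rightFrechetModule A.

Lemma frechet_hausdorff (E : tvsType K) : frechet E -> hausdorff_space E.
Proof. by move=> [[]]. Qed.

Lemma module_map_id M : module_map (@id M).
Proof. by split=> //; exact: clin_id. Qed.

Lemma module_map_zero M N : module_map (fun _ : M => 0 : N).
Proof.
split; first exact: clin_zero.
by move=> v a; have [-> _ _ _ _] := linear_eqs (ract_linearl (r := N) a).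
Qed.

Lemma module_map_comp L M N (g : M -> N) (f : L -> M) :
  module_map g -> module_map f -> module_map (fun x => g (f x)).
Proof.
move=> [gc ga] [fc fa]; split; first exact: clin_comp.
by move=> v a; rewrite fa ga.
Qed.

Lemma module_map_sub M N (f g : M -> N) :
  module_map f -> module_map g -> module_map (fun x => f x - g x).
Proof.
move=> [fc fa] [gc ga]; split; first exact: clin_sub.
move=> v a; rewrite fa ga.
by have [_ _ _ -> _] := linear_eqs (ract_linearl (r := N) a).
Qed.

Lemma module_map_linear M N (f : M -> N) : module_map f -> linear f.
Proof. by case=> -[]. Qed.

(** The map [k] is only linear, since the case of interest is [id - f \o s] with
    [s] a continuous linear section; what makes its kernel a submodule is
    stability under the action. *)
Lemma kernel_module N (F : tvsType K) (k : N -> F) :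
    continuous_linear k -> hausdorff_space F ->
    (forall v a, k v = 0 -> k (ract v a) = 0) ->
  exists (Z : rightFrechetModule A) (i : Z -> N),
    [/\ module_map i, injective i, forall z, k (i z) = 0
      & forall (T : tvsType K) (f : T -> N), continuous_linear f ->
          (forall x, k (f x) = 0) ->
          exists2 g : T -> Z, continuous_linear g & forall x, i (g x) = f x].
Proof.
move=> [kl kc] hF kact.
have [cN [P [Pc sP tP]]] := rmod_frechet N.
pose Z := seminormed (kernel_seminorm (kl := kl) sP).
pose val : Z -> N := @ker_val _ _ _ _ kl.
have vl : linear val := @ker_val_linear _ _ _ _ kl.
have vi : injective val := @ker_val_inj _ _ _ _ kl.
have vc : continuous val := ker_val_continuous tP.
have vk z : k (val z) = 0 := ker_valE z.
have actP (z : Z) a : ract (val z) a \in ker_pred kl.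
  by rewrite unfold_in kact.
pose act (z : Z) a : Z := Kernel (actP z a).
have actE z a : val (act z a) = ract (val z) a by [].
have [v0 vD vN vB vZ] := linear_eqs vl.
have act_linl a : linear (act^~ a).
  by move=> c u v; apply: vi; rewrite vD vZ !actE vD vZ; exact: ract_linearl.
have act_linr v : linear (act v).
  by move=> c a b; apply: vi; rewrite vD vZ !actE; exact: ract_linearr.
have act1 v : act v 1 = v by apply: vi; rewrite actE ract1.
have actM v a b : act v (a * b) = act (act v a) b.
  by apply: vi; rewrite !actE ractM.
have act_cont : continuous (fun z : Z * A => act z.1 z.2).
  apply: (kernel_corestrict tP) => z.
  apply: (@continuous_comp _ _ _ (fun z : Z * A => (val z.1, z.2))
    (fun z => ract z.1 z.2)); last exact: ract_continuous.
  exact: continuous_map_fst.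
have fZ : frechet (Z : tvsType K) by exact: kernel_frechet.
pose Zm := RightFrechetModule fZ
  act_linl act_linr act1 actM act_cont.
exists Zm, val; split=> //.
move=> T f [fl fc] fk.
have fP x : f x \in ker_pred kl by rewrite unfold_in fk.
pose g x : Zm := Kernel (fP x).
exists g => //; split; last exact: (kernel_corestrict tP).
by move=> c x y; apply: vi; rewrite vD vZ; exact: fl.
Qed.

(** Lifting through a map [f] whose image is complemented as a topological
    vector space: the condition [f \o s \o f = f] makes this image the kernel
    of [id - f \o s], hence a Frechet module onto which [f] is an admissible
    epimorphism. *)
Lemma projective_lift Q M N (f : M -> N) (s : N -> M) (g : Q -> N) :
    projective Q -> module_map f -> continuous_linear s -> module_map g ->
    (forall m, f (s (f m)) = f m) -> (forall p, f (s (g p)) = g p) ->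
  exists2 h : Q -> M, module_map h & forall p, f (h p) = g p.
Proof.
move=> pQ fm sc gm fsf fsg; have [[fc fa] [gc ga]] := (fm, gm).
pose k n := n - f (s n).
have kc : continuous_linear k.
  by apply: clin_sub; [exact: clin_id|exact: clin_comp fc sc].
have kE n : k n = 0 -> n = f (s n) by move/eqP; rewrite subr_eq0 => /eqP.
have kf m : k (f m) = 0 by rewrite /k fsf subrr.
have [|Z [i [im ii iz lift]]] :=
  kernel_module kc (frechet_hausdorff (rmod_frechet N)).
  by move=> v a /kE ->; rewrite -fa kf.
have [f' f'c if'] := lift _ _ fc kf.
have kg p : k (g p) = 0 by rewrite /k fsg subrr.
have [g' g'c ig'] := lift _ _ gc kg.
have f'm : module_map f'.
  by split=> // v a; apply: ii; have [_ ->] := im; rewrite !if' fa.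
have g'm : module_map g'.
  by split=> // v a; apply: ii; have [_ ->] := im; rewrite !ig' ga.
have f'epi : admissible_epi f'.
  split=> //; exists (fun z => s (i z)); first by apply: clin_comp => //; case: im.
  by move=> z; apply: ii; rewrite if' -kE.
have [h hm f'h] := pQ _ _ _ _ f'epi g'm.
by exists h => // p; rewrite -if' f'h ig'.
Qed.

End Modules.

(** * Comparison of resolutions *)

Lemma dependent_choice_nat (S : nat -> Type) (R : forall n, S n -> S n.+1 -> Prop)
    (s0 : S 0) : (forall n s, exists s', @R n s s') ->
  exists2 f : forall n, S n, f 0 = s0 & forall n, R n (f n) (f n.+1).
Proof.
move=> h; pose next n s := sval (cid (h n s)).
exists (nat_rect S s0 next) => // n.
exact: svalP (cid (h n _)).
Qed.

Section Comparison.
Variables (K : numFieldType) (A : tvsAlgType K).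

Record module_complex := ModuleComplex {
  cpx_mod :> nat -> rightFrechetModule A;
  cpx_d : forall n, cpx_mod n.+1 -> cpx_mod n;
  cpx_dmap : forall n, module_map (@cpx_d n);
  cpx_dd : forall n v, cpx_d (@cpx_d n.+1 v) = 0
}.

(** The homotopy consists of continuous linear maps and not of module maps: this
    is the exactness that admissible resolutions have. *)
Definition contractible (C : module_complex) : Prop :=
  exists h : forall n, C n -> C n.+1,
    [/\ forall n, continuous_linear (h n), forall v, cpx_d (h 0 v) = v
      & forall n v, cpx_d (h n.+1 v) + h n (cpx_d v) = v].

(** Since [f n \o d] takes values in cycles, a contraction of [Q] writes it as
    [d \o h \o f n \o d], so it can be lifted along [d]. This condition on [f n],
    named [ok] in the proof, is carried along the recursion. *)
Lemma comparison_map (P Q : module_complex) (f0 : P 0 -> Q 0) :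
    (forall n, projective (P n.+1)) -> contractible Q -> module_map f0 ->
  exists2 f : forall n, P n -> Q n, f 0 = f0
    & forall n, module_map (f n) /\ forall v, cpx_d (f n.+1 v) = f n (cpx_d v).
Proof.
move=> pP [h [hc h0 hS]] f0m.
have dhd n v : cpx_d (h n (cpx_d v)) = cpx_d v :> Q n.
  case: n v => [|n] v; first exact: h0.
  have := hS n (cpx_d v); rewrite cpx_dd.
  by have [-> _ _ _ _] := linear_eqs (hc n).1; rewrite addr0.
pose ok n (f : P n -> Q n) := module_map f /\
  forall v : P n.+1, cpx_d (h n (f (cpx_d v))) = f (cpx_d v).
have ok0 : ok 0 f0 by split.
have [|f ff0 fS] := @dependent_choice_nat (fun n => {f | @ok n f})
    (fun n f g => forall v, cpx_d (sval g v) = sval f (cpx_d v)) (exist _ _ ok0).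
  move=> n [f [fm fh]] /=.
  have [g gm gf] := projective_lift (pP n) (cpx_dmap Q n) (hc n)
    (module_map_comp fm (cpx_dmap P n)) (@dhd n) fh.
  have okg : @ok n.+1 g.
    split=> // v; have := hS n (g (cpx_d v)); rewrite gf cpx_dd.
    have [-> _ _ _ _] := linear_eqs (module_map_linear fm).
    by have [-> _ _ _ _] := linear_eqs (hc n).1; rewrite addr0.
  by exists (exist _ g okg).
exists (fun n => sval (f n)); first by rewrite ff0.
by move=> n; split; [have [] := svalP (f n)|exact: fS].
Qed.

(** The map [f - id - s \o d] takes values in cycles, which are boundaries by
    contractibility, so the next stage of the homotopy is obtained by lifting
    it. *)
Lemma comparison_homotopy (P : module_complex) (f : forall n, P n -> P n) :
    (forall n, projective (P n.+1)) -> contractible P ->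
    (forall n, module_map (f n)) -> (forall v, f 0 v = v) ->
    (forall n v, cpx_d (f n.+1 v) = f n (cpx_d v)) ->
  exists s : forall n, P n -> P n.+1,
    [/\ forall n, module_map (s n), forall v, s 0 v = 0
      & forall n v, cpx_d (s n.+1 v) + s n (cpx_d v) = f n.+1 v - v].
Proof.
move=> pP [h [hc h0 hS]] fm f0 fd.
have dl n : linear (@cpx_d P n) := module_map_linear (cpx_dmap P n).
have dhd n v : cpx_d (h n (cpx_d v)) = cpx_d v :> P n.
  case: n v => [|n] v; first exact: h0.
  have := hS n (cpx_d v); rewrite cpx_dd.
  by have [-> _ _ _ _] := linear_eqs (hc n).1; rewrite addr0.
pose ok n (s : P n -> P n.+1) := module_map s /\
  forall v, cpx_d (f n.+1 v - v - s (cpx_d v)) = 0.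
have ok0 : ok 0 (fun=> 0).
  split; first exact: module_map_zero.
  move=> v; have [_ _ _ dB _] := linear_eqs (dl 0).
  by rewrite subr0 dB fd f0 subrr.
have [|s s0 sS] := @dependent_choice_nat (fun n => {s | @ok n s})
    (fun n s t => forall v, cpx_d (sval t v) + sval s (cpx_d v) = f n.+1 v - v)
    (exist _ _ ok0).
  move=> n [s [sm sd]] /=.
  have gm : module_map (fun v => f n.+1 v - v - s (cpx_d v)).
    apply: module_map_sub; last exact: module_map_comp sm (cpx_dmap P n).
    by apply: module_map_sub => //; exact: module_map_id.
  have hg v : cpx_d (h n.+1 (f n.+1 v - v - s (cpx_d v)))
      = f n.+1 v - v - s (cpx_d v).
    have := hS n (f n.+1 v - v - s (cpx_d v)); rewrite sd.
    by have [-> _ _ _ _] := linear_eqs (hc n).1; rewrite addr0.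
  have [t tm tE] := projective_lift (pP n) (cpx_dmap P n.+1) (hc n.+1) gm
    (@dhd n.+1) hg.
  have okt : @ok n.+1 t.
    split=> // v; have [_ _ _ dB _] := linear_eqs (dl n.+1).
    rewrite dB tE dB fd cpx_dd.
    have [-> _ _ _ _] := linear_eqs (module_map_linear sm).
    by rewrite subr0 subrr.
  by exists (exist _ t okt) => /= v; rewrite tE subrK.
exists (fun n => sval (s n)); split=> //.
- by move=> n; have [] := svalP (s n).
- by rewrite s0.
Qed.

End Comparison.

Section Resolutions.
Variables (K : numFieldType) (A : tvsAlgType K) (Y : rightFrechetModule A).

Section Augmented.
Variables (P : nat -> rightFrechetModule A) (d : forall n, P n.+1 -> P n).
Variables (e : P 0 -> Y) (res : admissible_resolution d e).

(** The indices are shifted by one: [Y] sits in degree 0 and the augmentation is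
    the first differential. *)
Definition augmented n : rightFrechetModule A := if n is m.+1 then P m else Y.

Definition augmented_d n : augmented n.+1 -> augmented n :=
  match n with 0 => e | m.+1 => @d m end.

Lemma augmented_dmap n : module_map (@augmented_d n).
Proof. by case: res => em dm _ _ _; case: n. Qed.

Lemma augmented_dd n v : augmented_d (@augmented_d n.+1 v) = 0.
Proof. by case: res => _ _ ed dd _; case: n v => [|n] v; [exact: ed|exact: dd]. Qed.

Definition augmented_complex := ModuleComplex augmented_dmap augmented_dd.

Lemma augmented_contractible : contractible augmented_complex.
Proof.
case: res => _ _ _ _ [s [h [sc hc es hs hS]]].
exists (fun n => match n return augmented n -> augmented n.+1 with
  0 => s | m.+1 => h m end).
by split=> [[|n]|v|[|n] v]; [exact: sc|exact: hc|exact: es|exact: hs|exact: hS].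
Qed.

End Augmented.

(** Two projective resolutions of [Y] are homotopy equivalent; only the half of
    the equivalence that retracts [P] onto [Q] is recorded. *)
Lemma resolution_homotopy_equiv (P Q : nat -> rightFrechetModule A)
    (dP : forall n, P n.+1 -> P n) (eP : P 0 -> Y)
    (dQ : forall n, Q n.+1 -> Q n) (eQ : Q 0 -> Y) :
    projective_resolution dP eP -> projective_resolution dQ eQ ->
  exists (f : forall n, P n -> Q n) (g : forall n, Q n -> P n)
      (s : forall n, P n -> P n.+1),
    [/\ forall n, [/\ module_map (f n), module_map (g n) & module_map (s n)],
        forall n v, dQ n (f n.+1 v) = f n (dP n v),
        forall n v, dP n (g n.+1 v) = g n (dQ n v),
        forall v, dP 0 (s 0 v) = g 0 (f 0 v) - v
      & forall n v, dP n.+1 (s n.+1 v) + s n (dP n v) = g n.+1 (f n.+1 v) - v].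
Proof.
move=> [pP rP] [pQ rQ].
have cP := augmented_contractible rP; have cQ := augmented_contractible rQ.
have [f f0 fS] := comparison_map (P := augmented_complex rP) pP cQ (module_map_id Y).
have [g g0 gS] := comparison_map (P := augmented_complex rQ) pQ cP (module_map_id Y).
have [||| s [sm s0 sS]] := @comparison_homotopy _ _ (augmented_complex rP)
    (fun n v => g n (f n v)) pP cP.
- by move=> n; apply: module_map_comp; [case: (gS n)|case: (fS n)].
- by move=> v; rewrite f0 g0.
- by move=> n v; rewrite (gS n).2 (fS n).2.
exists (fun n => f n.+1), (fun n => g n.+1), (fun n => s n.+1); split.
- by move=> n; split; [case: (fS n.+1)|case: (gS n.+1)|exact: (sm n.+1)].
- by move=> n v; exact: (fS n.+1).2.
- by move=> n v; exact: (gS n.+1).2.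
- by move=> v; have := sS 0 v; rewrite s0 addr0.
- by move=> n v; exact: sS n.+1 v.
Qed.

End Resolutions.

(** * Tensor products and Tor *)

Section Tensor.
Variables (K : numFieldType) (A : tvsAlgType K) (X : leftFrechetModule A).
Implicit Types M N : rightFrechetModule A.

Lemma tensor_ext M (T E : tvsType K) (t : M -> X -> T) (f g : T -> E) :
    tensor_product t -> complete_lcs E -> continuous_linear f ->
    continuous_linear g -> (forall m x, f (t m x) = g (t m x)) -> f =1 g.
Proof.
move=> [fT [tl tr tc tb] tu] cE fc gc fg.
have [|h [hc ht hu]] := tu E (fun m x => f (t m x)) cE.
  have [fl fcc] := fc; split.
  - by move=> x k u v; rewrite tl fl.
  - by move=> m k u v; rewrite tr fl.
  - move=> z; apply: continuous_comp; [exact: tc|exact: fcc].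
  - by move=> m a x; rewrite tb.
by move=> u; rewrite (hu f) ?(hu g).
Qed.

Lemma tensor_map M N (T T' : tvsType K) (t : M -> X -> T) (t' : N -> X -> T')
    (f : M -> N) : tensor_product t -> tensor_product t' -> module_map f ->
  exists2 F : T -> T', continuous_linear F & forall m x, F (t m x) = t' (f m) x.
Proof.
move=> [_ _ tu] [[cT' _] [tl tr tc tb] _] [[fl fc] fa].
have [|F [Fc Ft _]] := tu T' (fun m x => t' (f m) x) cT'; last by exists F.
split.
- by move=> x k u v; rewrite fl tl.
- by move=> m k u v; rewrite tr.
- move=> z; apply: (@continuous_comp _ _ _ (fun z : M * X => (f z.1, z.2))
    (fun z => t' z.1 z.2)); last exact: tc.
  exact: continuous_map_fst.
- by move=> m a x; rewrite fa tb.
Qed.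

(** Tensoring with [X] is functorial for module maps and compatible with their
    identities, by uniqueness in the universal property. It therefore preserves
    the homotopy equivalence of two resolutions, so the vanishing of Tor can be
    read on a single one. *)
Lemma Tor_vanishes_resolution (Y : rightFrechetModule A)
    (Q : nat -> rightFrechetModule A) (dQ : forall n, Q n.+1 -> Q n)
    (eQ : Q 0 -> Y) (U : nat -> tvsType K) (u : forall n, Q n -> X -> U n)
    (DQ : forall n, U n.+1 -> U n) (k : nat) :
    projective_resolution dQ eQ -> (forall n, tensor_product (u n)) ->
    (forall n, continuous_linear (DQ n)) ->
    (forall n p x, DQ n (u n.+1 p x) = u n (dQ n p) x) ->
  homology_vanishes DQ k <-> Tor_vanishes Y X k.
Proof.
move=> rQ uT DQc DQu; split; last by move/(_ _ _ _ rQ _ _ _ uT DQc DQu).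
move=> hQ P dP eP rP T t D tT Dc Dt.
have [f [g [s [fgs df dg s0 sS]]]] := resolution_homotopy_equiv rP rQ.
have cT n : complete_lcs (T n) by case: (tT n) => -[].
have cU n : complete_lcs (U n) by case: (uT n) => -[].
have [F Fc Ft] : exists2 F : forall n, T n -> U n,
    forall n, continuous_linear (F n) & forall n p x, F n (t n p x) = u n (f n p) x.
  have h n : {F : T n -> U n | continuous_linear F /\
      forall p x, F (t n p x) = u n (f n p) x}.
    have [fm _ _] := fgs n; apply: cid.
    by have [F Fc Ft] := tensor_map (tT n) (uT n) fm; exists F.
  by exists (fun n => sval (h n)) => n; case: (svalP (h n)).
have [G Gc Gu] : exists2 G : forall n, U n -> T n,
    forall n, continuous_linear (G n) & forall n p x, G n (u n p x) = t n (g n p) x.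
  have h n : {G : U n -> T n | continuous_linear G /\
      forall p x, G (u n p x) = t n (g n p) x}.
    have [_ gm _] := fgs n; apply: cid.
    by have [G Gc Gu] := tensor_map (uT n) (tT n) gm; exists G.
  by exists (fun n => sval (h n)) => n; case: (svalP (h n)).
have [H Hc Ht] : exists2 H : forall n, T n -> T n.+1,
    forall n, continuous_linear (H n) & forall n p x, H n (t n p x) = t n.+1 (s n p) x.
  have h n : {H : T n -> T n.+1 | continuous_linear H /\
      forall p x, H (t n p x) = t n.+1 (s n p) x}.
    have [_ _ sm] := fgs n; apply: cid.
    by have [H Hc Ht] := tensor_map (tT n) (tT n.+1) sm; exists H.
  by exists (fun n => sval (h n)) => n; case: (svalP (h n)).
have tlin n x : linear ((t n)^~ x) by case: (tT n) => _ [].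
have tB n x := let: And5 _ _ _ h _ := linear_eqs (tlin n x) in h.
have tD n x := let: And5 _ h _ _ _ := linear_eqs (tlin n x) in h.
have t0 n x := let: And5 h _ _ _ _ := linear_eqs (tlin n x) in h.
have DF n : (fun z => DQ n (F n.+1 z)) =1 (fun z => F n (D n z)).
  apply: (tensor_ext (tT n.+1) (cU n)); [exact: clin_comp|exact: clin_comp|].
  by move=> p x; rewrite Ft DQu Dt Ft df.
have DG n : (fun z => D n (G n.+1 z)) =1 (fun z => G n (DQ n z)).
  apply: (tensor_ext (uT n.+1) (cT n)); [exact: clin_comp|exact: clin_comp|].
  by move=> p x; rewrite Gu Dt DQu Gu dg.
have DH0 : (fun z => D 0 (H 0 z)) =1 (fun z => G 0 (F 0 z) - z).
  apply: (tensor_ext (tT 0) (cT 0)); first exact: clin_comp.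
    by apply: clin_sub; [exact: clin_comp|exact: clin_id].
  by move=> p x; rewrite Ht Dt s0 Ft Gu tB.
have DHS n : (fun z => D n.+1 (H n.+1 z) + H n (D n z))
    =1 (fun z => G n.+1 (F n.+1 z) - z).
  apply: (tensor_ext (tT n.+1) (cT n.+1)).
  - by apply: clin_add; exact: clin_comp.
  - by apply: clin_sub; [exact: clin_comp|exact: clin_id].
  - by move=> p x; rewrite Ht Dt Dt Ht -tD sS Ft Gu tB.
have DB n := let: And5 _ _ _ h _ := linear_eqs (Dc n).1 in h.
have DQB n := let: And5 _ _ _ h _ := linear_eqs (DQc n).1 in h.
case: k hQ => [|k] /= hQ; apply/seteqP; split=> // z.
- move=> _; have : range (DQ 0) (F 0 z) by rewrite hQ.
  move=> [w _ wz]; exists (G 1 w - H 0 z) => //.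
  have := DH0 z; rewrite /= DB => ->; have /= -> := DG 0 w.
  by rewrite wz subKr.
- move=> /= Dz; have : [set v | DQ k v = 0] (F k.+1 z).
    by rewrite /=; have /= -> := DF k z; rewrite Dz; have [->] := linear_eqs (Fc k).1.
  rewrite hQ => -[w _ wz]; exists (G k.+2 w - H k.+1 z) => //.
  have := DHS k z; rewrite /= Dz; have [-> _ _ _ _] := linear_eqs (Hc k).1.
  by rewrite addr0 DB => ->; have /= -> := DG k.+1 w; rewrite wz subKr.
move=> [w _ <-] /=.
have DD : (fun z => D k (D k.+1 z)) =1 (fun=> 0).
  apply: (tensor_ext (tT k.+2) (cT k)); [exact: clin_comp|exact: clin_zero|].
  move=> p x; rewrite !Dt; have [_ [_ _ _ dd _]] := rP.
  by rewrite dd t0.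
exact: DD.
Qed.

End Tensor.

(** * The universal property of the envelope *)

Section SeminormedAlgebra.
Variables (K : numFieldType) (V : algType K) (P : set (V -> K)).
Variable (sP : P `<=` @seminorm K V).

HB.instance Definition _ := GRing.Algebra.on (seminormed sP).

Lemma seminormed_arens_michael :
  (forall p, P p -> forall a b, p (a * b) <= p a * p b) ->
  complete_lcs (seminormed sP) -> arens_michael (seminormed sP).
Proof.
by move=> mP cV; split=> //; exists P; split=> //; exact: seminormed_topology.
Qed.

End SeminormedAlgebra.

Section Subalgebra.
Variables (K : numFieldType) (A : algType K) (S : set A).

(** The closure properties are a phantom argument, by which they are found. *)
Definition subalgebra_mem (hS : GRing.subalg_closed (fun a => `[< S a >])) :
  {pred A} := fun a => `[< S a >].

Variable hS : GRing.subalg_closed (fun a => `[< S a >]).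

HB.instance Definition _ :=
  GRing.isSubalgClosed.Build K A (subalgebra_mem hS) hS.

Record subalgebra := Subalgebra {
  subalgebra_val : A; subalgebra_valP : subalgebra_val \in subalgebra_mem hS }.

HB.instance Definition _ := [isSub for subalgebra_val].
HB.instance Definition _ := [Choice of subalgebra by <:].
HB.instance Definition _ := [SubChoice_isSubAlgebra of subalgebra by <:].

Lemma subalgebra_val_linear : linear subalgebra_val.
Proof. by move=> c u v; exact: (linearP (val : {linear subalgebra -> A})). Qed.

Lemma subalgebra_val_monoid : monoid_morphism subalgebra_val.
Proof.
by split=> [|a b]; [exact: (rmorph1 (val : {rmorphism subalgebra -> A}))
                   |exact: (rmorphM (val : {rmorphism subalgebra -> A}))].
Qed.

Lemma subalgebra_val_inj : injective subalgebra_val.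
Proof. exact: val_inj. Qed.

Lemma subalgebra_valE (a : subalgebra) : S (subalgebra_val a).
Proof. by case: a => a /= /asboolP. Qed.

End Subalgebra.

Section Universal.
Variables (K : numFieldType).

(** The universal property of the envelope in terms of the images of the two
    generators. In this form it is symmetric under exchanging [x] with [y] and
    [q] with [q^-1], see [q_universal_swap]. *)
Definition q_universal (q : K) (A : tvsAlgType K) (x y : A) : Prop :=
  [/\ arens_michael A, x * y = q^-1 *: (y * x),
    forall (B : tvsAlgType K) (X Y : B), arens_michael B ->
      X * Y = q^-1 *: (Y * X) -> exists g : {lrmorphism A -> B},
        [/\ continuous g, g x = X & g y = Y]
    & forall (B : tvsAlgType K) (g g' : {lrmorphism A -> B}),
      arens_michael B -> continuous g -> continuous g' ->
      g x = g' x -> g y = g' y -> g =1 g'].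

Lemma envelope_q_universal (q : K) (A : tvsAlgType K)
    (w : {lrmorphism quantum_plane q -> A}) :
  arens_michael_envelope w -> q_universal q (w (qx q)) (w (qy q)).
Proof.
move=> [amA uA]; split=> //.
- have [_ _ _ _ wZ] := linear_eqs (linearP w).
  by have := congr1 w (QPlane.qxy q); rewrite rmorphM wZ rmorphM.
- move=> B X Y amB XY.
  have [f [fx fy]] := QPlaneUniversal.quantum_plane_hom XY.
  by have [g [gc gw _]] := uA B f amB; exists g; rewrite !gw.
- move=> B g g' amB gc g'c gx gy.
  have [h [hc hw hu]] := uA B (g \o w : {lrmorphism _ -> _}) amB.
  move=> a; rewrite (hu g)// (hu g')// => u; rewrite -hw.
  have := @QPlaneUniversal.quantum_plane_ext _ _ _
    (g' \o w : {lrmorphism _ -> _}) (g \o w : {lrmorphism _ -> _}).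
  by move=> /(_ (esym gx) (esym gy) u) /= ->; rewrite hw.
Qed.

End Universal.

Section Full.
Variables (K : numFieldType) (q : K) (A : tvsAlgType K) (x y : A).
Hypothesis uA : q_universal q x y.

Section FinerSubalgebra.
Variables (S : set A) (P : set (A -> K)).
Hypothesis hS : GRing.subalg_closed (fun a => `[< S a >]).
Hypotheses (Sx : S x) (Sy : S y).
Hypothesis sP : forall p, P p -> [/\ forall a, S a -> 0 <= p a,
  forall a b, S a -> S b -> p (a + b) <= p a + p b,
  forall k a, S a -> p (k *: a) = `|k| * p a
  & forall a b, S a -> S b -> p (a * b) <= p a * p b].
Hypothesis finerP : forall U : set A, nbhs 0 U ->
  exists (F : set (A -> K)) (e : K), [/\ F `<=` P, finite_set F, 0 < e
    & forall a, S a -> (forall p, F p -> p a < e) -> U a].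
Hypothesis supP : forall p, P p -> exists Q : set (A -> K),
  Q `<=` @continuous_seminorm K A /\
  forall a e, S a -> 0 < e -> (p a <= e <-> forall s, Q s -> s a <= e).
Hypothesis limP : forall (G : set_system A) (l : A), ProperFilter G -> G S ->
  (forall p e, P p -> 0 < e -> exists2 B, G B &
     forall a b, S a -> S b -> B a -> B b -> p (a - b) < e) ->
  G --> l -> S l.

(** A subalgebra [S] through the generators, complete for a finer topology, is
    everything: the universal property sends [A] back into [S], and the
    composite [A -> S -> A] fixes the generators, hence is the identity. Its
    continuity shows moreover that the topology of [S] is that of [A]. *)
Lemma finer_subalgebra_full :
  (forall a, S a) /\ forall p, P p -> continuous_seminorm p.
Proof.
have [amA xy hom uniq] := uA; have [cA _] := amA.
pose V := subalgebra hS.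
pose v : V -> A := @subalgebra_val _ _ _ hS.
have vl : linear v := @subalgebra_val_linear _ _ _ hS.
have [v0 vD vN vB vZ] := linear_eqs vl.
have vm : monoid_morphism v := @subalgebra_val_monoid _ _ _ hS.
have vi : injective v := @subalgebra_val_inj _ _ _ hS.
have vS a : S (v a) := subalgebra_valE a.
pose PV := [set p \o v | p in P].
have sPV : PV `<=` @seminorm K V.
  move=> _ [p /sP[p0 pD pZ _] <-]; split=> [a|a b|k a] /=.
  - exact: p0.
  - by have := pD _ _ (vS a) (vS b); rewrite -vD.
  - by have := pZ k _ (vS a); rewrite -vZ.
have iB : forall U : set A, nbhs 0 U ->
    exists (F : set (V -> K)) (e : K), [/\ F `<=` PV, finite_set F, 0 < e
      & [set z | forall p, F p -> p z < e] `<=` v @^-1` U].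
  move=> U /finerP[F [e [FP fF e0 FU]]]; exists [set p \o v | p in F], e.
  split=> //; [by move=> _ [p /FP Pp <-]; exists p|exact: finite_image|].
  by move=> a h; apply: FU => // p Fp; apply: (h (p \o v)); exists p.
pose B : tvsAlgType K := seminormed sPV.
have cB : complete_lcs (B : tvsType K).
  apply: (@seminormed_complete _ _ _ sPV A v vl vi cA iB).
  - move=> _ [p /supP[Q [Qc Qp]] <-]; exists Q; split=> //.
    by move=> a e e0; exact: Qp.
  - move=> G l GF cG Gl.
    have Sl : S l.
      apply: (limP (fmap_proper_filter v GF)) => //.
        by apply: (@filterS _ G _ setT) filterT => a _; exact: vS.
      move=> p e Pp e0; have [||D GD hD] := cG (p \o v) e => //; first by exists p.
      exists (v @` D).
        by apply: (@filterS _ G _ D _ _ GD) => a Da; exists a.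
      by move=> _ _ _ _ [a Da <-] [b Db <-]; rewrite -vB; exact: hD.
    have lS : l \in subalgebra_mem hS by exact/asboolP.
    by exists (Subalgebra lS).
have amB : arens_michael B.
  apply: seminormed_arens_michael => // _ [p /sP[_ _ _ pM] <-] a b /=.
  by have := pM _ _ (vS a) (vS b); rewrite -(vm.2 a b).
have xS : x \in subalgebra_mem hS by exact/asboolP.
have yS : y \in subalgebra_mem hS by exact/asboolP.
have XY : (Subalgebra xS : B) * Subalgebra yS
    = q^-1 *: ((Subalgebra yS : B) * Subalgebra xS).
  by apply: vi; rewrite vZ !(vm.2 _ _).
have [g [gc gx gy]] := hom B _ _ amB XY.
have [vh vhE] := @lrmorphism_ex K B A v vl vm.
have vc : continuous (v : B -> A) := seminormed_inj_continuous vl iB.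
have vhc : continuous vh by rewrite (_ : vh = v :> (B -> A))//; exact/funext.
have vg a : v (g a) = a.
  rewrite -vhE; apply: (uniq A (vh \o g : {lrmorphism A -> A}) idfun amA).
  - by move=> z; apply: continuous_comp; [exact: gc|exact: vhc].
  - by move=> z; exact: cvg_id.
  - by rewrite /= vhE gx.
  - by rewrite /= vhE gy.
have Sall a : S a by rewrite -(vg a).
split=> // p Pp; have [p0 pD pZ _] := sP Pp; split.
  by split=> *; [exact: p0|exact: pD|exact: pZ].
move=> e e0; have PVp : PV (p \o v) by exists p.
have := seminormed_ball (sP := sPV) (g 0) PVp e0.
move=> /gc; have [-> _ _ _ _] := linear_eqs (linearP g).
move=> h; have {}h : nbhs 0 [set a | (p \o v) ((g a : V) - 0) < e] := h.
apply: (filterS _ h) => a ha; have : p (v ((g a : V) - 0)) < e := ha.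
by rewrite subr0 vg.
Qed.

End FinerSubalgebra.

(** This is [finer_subalgebra_full] for the induced topology: the subalgebra
    generated by [x] and [y] is dense. *)
Lemma q_universal_dense (S : set A) :
    GRing.subalg_closed (fun a => `[< S a >]) -> S x -> S y ->
    (forall (G : set_system A) l, ProperFilter G -> G S -> G --> l -> S l) ->
  forall a, S a.
Proof.
move=> hS Sx Sy Slim; have [[_ [P [sP mP tP]]] _ _ _] := uA.
apply: (proj1 (@finer_subalgebra_full S P hS Sx Sy _ _ _ _)).
- move=> p Pp; have [p0 pD pZ] := sP _ Pp.
  by split=> // a b _ _; exact: mP.
- move=> U /tP[F [e [FP fF e0 FU]]]; exists F, e; split=> // a _ h.
  exact: FU.
- move=> p Pp; exists [set p]; split.
    by move=> _ ->; exact: defines_topology_ball tP Pp.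
  by move=> a e _ e0; split=> [h _ ->//|]; apply.
- by move=> G l GF GS _; exact: Slim.
Qed.

End Full.

(** * The envelope is a Frechet algebra *)

Section Frechet.
Variables (R : realType).
Local Notation C := R[i].
Local Open Scope complex_scope.
Variables (q : C) (A : tvsAlgType C) (x y : A).
Hypothesis uA : q_universal q x y.

(** On a word in [x] and [y] these seminorms are bounded by a power of [n], and
    every continuous submultiplicative seminorm is of this kind for some [n].
    The value at 1 is bounded separately because it can exceed 1. *)
Definition bounded_seminorms (n : nat) : set (A -> C) := [set p |
  [/\ continuous_seminorm p, forall a b, p (a * b) <= p a * p b,
      p 1 <= n%:R, p x <= n%:R & p y <= n%:R]].

Definition bounded_elements : set A := [set a | forall n,
  exists c : C, forall p, bounded_seminorms n p -> p a <= c].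

(** The seminorms take nonnegative real values in [C], so the supremum is taken
    in [R]. *)
Definition sup_seminorm (n : nat) (a : A) : C :=
  (sup [set complex.Re (p a) | p in bounded_seminorms n])%:C.

Lemma ge0_ReE (z : C) : 0 <= z -> z = (complex.Re z)%:C.
Proof. by rewrite lecE => /andP[/eqP/= z0 _]; rewrite [LHS]complexE z0 mulr0 addr0. Qed.

Lemma bounded_seminorms0 n : bounded_seminorms n (fun=> 0).
Proof.
split=> [|a b|||]; rewrite ?mul0r//; split.
  by split=> // *; rewrite ?addr0 ?mulr0.
by move=> e e0; apply: (filterS _ filterT) => a _.
Qed.

Lemma bounded_seminorms_ge0 n p a : bounded_seminorms n p -> 0 <= p a.
Proof. by move=> [[sp _] _ _ _ _]; exact: seminorm_ge0. Qed.

Lemma sup_seminormP n a e : bounded_elements a ->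
  sup_seminorm n a <= e <-> forall p, bounded_seminorms n p -> p a <= e.
Proof.
move=> /(_ n)[c hc].
have ubs : has_ubound [set complex.Re (p a) | p in bounded_seminorms n].
  by exists (complex.Re c) => _ [p /hc pc <-]; move: pc; rewrite lecE => /andP[].
split=> [he p pn|he].
  apply: le_trans he; rewrite (ge0_ReE (bounded_seminorms_ge0 a pn)) lecR.
  by apply: ub_le_sup => //; exists p.
have e0 := he _ (bounded_seminorms0 n).
rewrite (ge0_ReE e0) lecR; apply: ge_sup.
  by exists 0, (fun=> 0); first exact: bounded_seminorms0.
by move=> _ [p /he pe <-]; move: pe; rewrite lecE => /andP[].
Qed.

Lemma sup_seminorm_le n a p : bounded_elements a -> bounded_seminorms n p ->
  p a <= sup_seminorm n a.
Proof. by move=> ba; exact: (proj1 (sup_seminormP n _ ba) (lexx _)). Qed.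

Lemma bounded_elements1 : bounded_elements 1.
Proof. by move=> n; exists n%:R => p []. Qed.

Lemma bounded_elementsD a b :
  bounded_elements a -> bounded_elements b -> bounded_elements (a + b).
Proof.
move=> ha hb n; have [[c hc] [d hd]] := (ha n, hb n).
exists (c + d) => p pn; have [[sp _] _ _ _ _] := pn.
by rewrite (le_trans (seminormD sp _ _))// lerD//; [exact: hc|exact: hd].
Qed.

Lemma bounded_elementsZ k a : bounded_elements a -> bounded_elements (k *: a).
Proof.
move=> ha n; have [c hc] := ha n; exists (`|k| * c) => p pn.
have [[sp _] _ _ _ _] := pn.
by rewrite seminormZ// ler_wpM2l//; exact: hc.
Qed.

Lemma bounded_elementsM a b :
  bounded_elements a -> bounded_elements b -> bounded_elements (a * b).
Proof.
move=> ha hb n; have [[c hc] [d hd]] := (ha n, hb n).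
exists (c * d) => p pn; have [[sp _] pM _ _ _] := pn.
by rewrite (le_trans (pM _ _))// ler_pM ?seminorm_ge0//; [exact: hc|exact: hd].
Qed.

Lemma bounded_subalg : GRing.subalg_closed (fun a => `[< bounded_elements a >]).
Proof.
split; first exact/asboolP/bounded_elements1.
  move=> k a b /asboolP ha /asboolP hb; apply/asboolP.
  by apply: bounded_elementsD => //; exact: bounded_elementsZ.
by move=> a b /asboolP ha /asboolP hb; exact/asboolP/bounded_elementsM.
Qed.

Lemma bounded_seminorms_ex p : continuous_seminorm p ->
  (forall a b, p (a * b) <= p a * p b) -> exists n, bounded_seminorms n p.
Proof.
move=> cp pM; have [sp _] := cp.
have bd z : 0 <= z -> exists n : nat, z <= n%:R :> C.
  move=> z0; exists (Num.bound (complex.Re z)); rewrite (ge0_ReE z0).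
  rewrite -(rmorph_nat (real_complex R)) lecR.
  have := archi_boundP (x := complex.Re z); move=> h; apply/ltW/h.
  by move: z0; rewrite lecE => /andP[].
have [n1 h1] := bd _ (seminorm_ge0 sp 1).
have [n2 h2] := bd _ (seminorm_ge0 sp x).
have [n3 h3] := bd _ (seminorm_ge0 sp y).
exists (n1 + n2 + n3)%N; split=> //.
- by rewrite (le_trans h1)// ler_nat -addnA leq_addr.
- by rewrite (le_trans h2)// ler_nat addnAC leq_addl.
- by rewrite (le_trans h3)// ler_nat leq_addl.
Qed.

(** The elements at which all the suprema are finite form a subalgebra through
    [x] and [y], and these suprema make it complete for a finer topology. By
    [finer_subalgebra_full] it is [A] with its own topology, which is therefore
    defined by countably many seminorms. *)
Lemma q_universal_frechet : frechet (A : tvsType C).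
Proof.
have [[cA [P [sP mP tP]]] _ _ _] := uA.
have QN p : P p -> exists n, bounded_seminorms n p.
  move=> Pp; apply: bounded_seminorms_ex; last exact: mP.
  exact: defines_topology_ball tP Pp.
have finer (U : set A) : nbhs 0 U ->
    exists (F : set (A -> C)) (e : C), [/\ F `<=` range sup_seminorm, finite_set F,
      0 < e & forall a, bounded_elements a -> (forall p, F p -> p a < e) -> U a].
  move=> /tP[F [e [FP fF e0 FU]]].
  have [N hN] : exists N : (A -> C) -> nat, forall p, P p -> bounded_seminorms (N p) p.
    have h p : {n : nat | P p -> bounded_seminorms n p}.
      apply: cid; have [/QN[n ?]|nP] := pselect (P p); first by exists n.
      by exists 0%N.
    by exists (fun p => sval (h p)) => p; exact: svalP (h p).
  exists [set sup_seminorm (N p) | p in F], e; split=> //.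
  - by move=> _ [p _ <-]; exists (N p).
  - exact: finite_image.
  - move=> a ba h; apply: FU => p Fp /=.
    apply: le_lt_trans (h _ _); last by exists p.
    by apply: sup_seminorm_le => //; apply/hN/FP.
have [|||||| ball1 csn] := @finer_subalgebra_full C q A x y uA bounded_elements
    (range sup_seminorm) bounded_subalg.
- by move=> n; exists n%:R => p [].
- by move=> n; exists n%:R => p [].
- move=> _ [n _ <-]; split.
  + by move=> a ba; exact: (sup_seminorm_le ba (bounded_seminorms0 n)).
  + move=> a b ba bb; apply/(sup_seminormP _ _ (bounded_elementsD ba bb)) => p pn.
    have [[sp _] _ _ _ _] := pn; rewrite (le_trans (seminormD sp _ _))//.
    by rewrite lerD// sup_seminorm_le.
  + have Zle k a : bounded_elements a ->
        sup_seminorm n (k *: a) <= `|k| * sup_seminorm n a.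
      move=> ba; apply/(sup_seminormP _ _ (bounded_elementsZ k ba)) => p pn.
      have [[sp _] _ _ _ _] := pn; rewrite seminormZ// ler_wpM2l//.
      exact: sup_seminorm_le.
    move=> k a ba; apply/eqP; rewrite eq_le Zle//=.
    have [->|k0] := eqVneq k 0.
      rewrite normr0 mul0r.
      exact: (sup_seminorm_le (bounded_elementsZ _ ba) (bounded_seminorms0 n)).
    have := Zle k^-1 (k *: a) (bounded_elementsZ _ ba).
    by rewrite scalerA mulVf// scale1r normfV ler_pdivlMl// normr_gt0.
  + move=> a b ba bb; apply/(sup_seminormP _ _ (bounded_elementsM ba bb)) => p pn.
    have [[sp _] pM _ _ _] := pn; rewrite (le_trans (pM _ _))//.
    by rewrite ler_pM ?seminorm_ge0// sup_seminorm_le.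
- exact: finer.
- move=> _ [n _ <-]; exists (bounded_seminorms n); split; first by move=> p [].
  by move=> a e ba _; exact: sup_seminormP.
- move=> G l GF GS cG Gl n.
  have [|B GB hB] := cG (sup_seminorm n) 1 _ ltr01; first by exists n.
  have [a [Ba ba]] := filter_ex (filterI GB GS).
  exists (1 + 1 + sup_seminorm n a) => p pn; have [[sp pc] _ _ _ _] := pn.
  have Gp := Gl _ (nbhs_ball_seminorm l (pc _ ltr01)).
  have [b [[Bb bb] /= lb]] := filter_ex (filterI (filterI GB GS) Gp).
  have pba : p (b - a) <= 1.
    have bba : bounded_elements (b - a).
      by apply: bounded_elementsD => //; rewrite -scaleN1r; exact: bounded_elementsZ.
    by rewrite (le_trans (sup_seminorm_le bba pn))//; exact/ltW/hB.
  have -> : l = (l - b) + (b - a) + a by rewrite addrA subrK subrK.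
  rewrite (le_trans (seminormD sp _ _))// lerD//; last exact: sup_seminorm_le.
  rewrite (le_trans (seminormD sp _ _))// lerD//.
  by rewrite seminorm_distC//; exact: ltW.
split=> //; exists (range sup_seminorm); split.
- exact: sub_countable (card_image_le _ _) _.
- by move=> p /csn[].
- move=> U; split=> [/finer[F [e [FP fF e0 FU]]]|[F [e [FP fF e0 FU]]]].
    by exists F, e; split=> // a; apply: FU.
  apply: (filterS FU); apply: filter_finite_forall => // p /FP/csn[_]; exact.
Qed.

End Frechet.

(** * Triangular matrices *)

Section ArensMichaelTheory.
Variables (K : numFieldType) (A : tvsAlgType K).
Hypothesis amA : arens_michael A.

Lemma arens_michael_mul_continuous : continuous (fun z : A * A => z.1 * z.2).
Proof.
have [_ [P [sP mP tP]]] := amA.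
move=> [a b] U /= /nbhs_shift /tP[F [e [FP fF e0 FU]]].
suff : nbhs (a, b) [set z : A * A | forall p, F p -> p (z.1 * z.2 - a * b) < e].
  apply: filterS => z /= h; have := FU (z.1 * z.2 - a * b).
  by rewrite /= [X in U X]addrC subrK; apply.
apply: filter_finite_forall => // p /FP Pp.
have [sp pc] := defines_topology_ball sP tP Pp.
have c0 : 0 < p a + p b + 1 by rewrite ltr_wpDl// addr_ge0// seminorm_ge0.
have [d [d0 d1 de]] : exists d : K, [/\ 0 < d, d <= 1 & d <= e / (p a + p b + 1) / 2].
  by apply: pos_lb2; rewrite ?divr_gt0.
exists ([set z | p (z - a) < d], [set z | p (z - b) < d]).
  by split; apply: nbhs_ball_seminorm; exact: pc.
move=> [z w] [/= za wb].
have -> : z * w - a * b = (z - a) * (w - b) + a * (w - b) + (z - a) * b.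
  by rewrite -(mulrDl (z - a) a (w - b)) subrK mulrBr mulrBl addrA subrK.
have [pza pwb] : 0 <= p (z - a) /\ 0 <= p (w - b) by split; exact: seminorm_ge0.
have [pa pb] : 0 <= p a /\ 0 <= p b by split; exact: seminorm_ge0.
have h1 : p (z - a) * p (w - b) <= d.
  by rewrite -[d]mulr1 ler_pM ?(ltW za)// (le_trans (ltW wb)).
have h2 : p a * p (w - b) <= p a * d by rewrite ler_wpM2l// ltW.
have h3 : p (z - a) * p b <= p b * d by rewrite mulrC ler_wpM2l// ltW.
have m1 := le_trans (mP _ Pp _ _) h1.
have m2 := le_trans (mP _ Pp _ _) h2.
have m3 := le_trans (mP _ Pp _ _) h3.
apply: (@le_lt_trans _ _ (d + p a * d + p b * d)).
  by rewrite (le_trans (seminormD sp _ _))// lerD// (le_trans (seminormD sp _ _))// lerD.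
have -> : d + p a * d + p b * d = (p a + p b + 1) * d by ring.
rewrite mulrC -ltr_pdivlMr// (le_lt_trans de)// ltr_pdivrMr// ltr_pMr ?divr_gt0//.
by rewrite ltr1n.
Qed.

Lemma clin_mull (c : A) : continuous_linear (fun a => c * a).
Proof.
split=> [k a b|a]; first by rewrite mulrDr scalerAr.
apply: (@continuous_comp _ _ _ (fun a => (c, a)) (fun z => z.1 * z.2)).
  by apply: cvg_pair; [exact: cvg_cst|exact: cvg_id].
exact: arens_michael_mul_continuous.
Qed.

Lemma clin_mulr (c : A) : continuous_linear (fun a => a * c).
Proof.
split=> [k a b|a]; first by rewrite mulrDl scalerAl.
apply: (@continuous_comp _ _ _ (fun a => (a, c)) (fun z => z.1 * z.2)).
  by apply: cvg_pair; [exact: cvg_id|exact: cvg_cst].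
exact: arens_michael_mul_continuous.
Qed.

End ArensMichaelTheory.

(** The algebra of upper triangular 2 x 2 matrices [[a, v], [0, b]], written
    [((a, v), b)]. *)
Definition triangular (A : Type) : Type := (A * A * A)%type.

Section Triangular.
Variables (K : numFieldType) (A : algType K).
Local Notation T := (triangular A).

HB.instance Definition _ := GRing.Lmodule.on T.

Definition tri_one : T := (1, 0, 1).
Definition tri_mul (z w : T) : T :=
  (z.1.1 * w.1.1, z.1.1 * w.1.2 + z.1.2 * w.2, z.2 * w.2).

Let mulA : associative tri_mul.
Proof.
move=> z w t; rewrite /tri_mul /=; congr (_, _, _); rewrite ?mulrA//.
by rewrite mulrDr mulrDl !mulrA addrA.
Qed.

Let mul1 : left_id tri_one tri_mul.
Proof. by move=> [[a v] b]; rewrite /tri_mul /= !mul1r mul0r addr0. Qed.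

Let tri_mulr1 : right_id tri_one tri_mul.
Proof. by move=> [[a v] b]; rewrite /tri_mul /= !mulr1 mulr0 add0r. Qed.

Let mulDl : left_distributive tri_mul +%R.
Proof.
move=> z w t; rewrite /tri_mul /= !mulrDl; congr (_, _, _).
by rewrite addrACA.
Qed.

Let mulDr : right_distributive tri_mul +%R.
Proof.
move=> z w t; rewrite /tri_mul /= !mulrDr; congr (_, _, _).
by rewrite addrACA.
Qed.

Let one_neq0 : tri_one != 0.
Proof. by apply/eqP => -[/eqP]; rewrite oner_eq0. Qed.

HB.instance Definition _ := GRing.Zmodule_isNzRing.Build T
  mulA mul1 tri_mulr1 mulDl mulDr one_neq0.

Let scaleAl k (z w : T) : k *: (z * w) = (k *: z : T) * w.
Proof.
move: z w => [[a v] b] [[a' v'] b'].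
have h : (k *: (a * a'), k *: (a * v' + v * b'), k *: (b * b')) =
  ((k *: a) * a', (k *: a) * v' + (k *: v) * b', (k *: b) * b').
  by rewrite scalerDr !scalerAl.
exact: h.
Qed.

HB.instance Definition _ := GRing.Lmodule_isLalgebra.Build K T scaleAl.

Let scaleAr k (z w : T) : k *: (z * w) = z * (k *: w).
Proof.
move: z w => [[a v] b] [[a' v'] b'].
have h : (k *: (a * a'), k *: (a * v' + v * b'), k *: (b * b')) =
  (a * (k *: a'), a * (k *: v') + v * (k *: b'), b * (k *: b')).
  by rewrite scalerDr !scalerAr.
exact: h.
Qed.

HB.instance Definition _ := GRing.Lalgebra_isAlgebra.Build K T scaleAr.

Definition tri_seminorm (p : A -> K) (z : T) : K := p z.1.1 + p z.1.2 + p z.2.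

End Triangular.

Section TriangularArensMichael.
Variables (K : numFieldType) (A : tvsAlgType K) (P : set (A -> K)).
Hypotheses (cA : complete_lcs A) (sP : P `<=` @seminorm K A).
Hypothesis mP : forall p, P p -> forall a b, p (a * b) <= p a * p b.
Hypothesis tP : defines_topology P.
Local Notation T := (triangular A).

Lemma tri_seminorms : [set tri_seminorm p | p in P] `<=` @seminorm K T.
Proof.
move=> _ [p /sP[p0 pD pZ] <-]; split=> [z|z w|k z]; rewrite /tri_seminorm.
- by rewrite !addr_ge0 ?p0.
- have := lerD (lerD (pD z.1.1 w.1.1) (pD z.1.2 w.1.2)) (pD z.2 w.2).
  by rewrite (addrACA (p z.1.1)) (addrACA (p z.1.1 + p z.1.2)).
- by rewrite !pZ -!mulrDr.
Qed.

Definition triangular_space : tvsAlgType K := seminormed tri_seminorms.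

Let E : tvsType K := (A * A * A)%type.

(** The identity, seen as a map into the product space, from which completeness
    is inherited. *)
Definition tri_inj (z : T) : E := z.

Lemma tri_inj_basis (U : set E) : nbhs 0 U ->
  exists (F : set (T -> K)) (e : K),
    [/\ F `<=` [set tri_seminorm p | p in P], finite_set F, 0 < e
      & [set z | forall p, F p -> p z < e] `<=` tri_inj @^-1` U].
Proof.
move=> [[W W3] /= [[[W1 W2] /= [W10 W20] W12] W30] WU].
have [F1 [e1 [FP1 fF1 e10 FW1]]] := proj1 (tP _) W10.
have [F2 [e2 [FP2 fF2 e20 FW2]]] := proj1 (tP _) W20.
have [F3 [e3 [FP3 fF3 e30 FW3]]] := proj1 (tP _) W30.
have [d [d0 d1 d2]] := pos_lb2 e10 e20.
have [e [e0 ed e3']] := pos_lb2 d0 e30.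
exists [set tri_seminorm p | p in F1 `|` F2 `|` F3], e; split=> //.
- by move=> _ [p [[/FP1|/FP2]|/FP3] Pp <-]; exists p.
- by apply: finite_image; rewrite !finite_setU.
move=> z h; apply: WU; split=> /=; [apply: W12; split=> /=|].
- apply: FW1 => p Fp /=; have [p0 _ _] := sP (FP1 _ Fp).
  rewrite (lt_le_trans _ d1)// (lt_le_trans _ ed)//.
  apply: le_lt_trans (h (tri_seminorm p) _); last by exists p => //; left; left.
  by rewrite /tri_seminorm -addrA lerDl addr_ge0.
- apply: FW2 => p Fp /=; have [p0 _ _] := sP (FP2 _ Fp).
  rewrite (lt_le_trans _ d2)// (lt_le_trans _ ed)//.
  apply: le_lt_trans (h (tri_seminorm p) _); last by exists p => //; left; right.
  by rewrite /tri_seminorm addrAC lerDr addr_ge0.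
- apply: FW3 => p Fp /=; have [p0 _ _] := sP (FP3 _ Fp).
  rewrite (lt_le_trans _ e3')//.
  apply: le_lt_trans (h (tri_seminorm p) _); last by exists p => //; right.
  by rewrite /tri_seminorm lerDr addr_ge0.
Qed.

Lemma tri_inj_continuous : continuous (tri_inj : triangular_space -> _).
Proof. by apply: seminormed_inj_continuous; [|exact: tri_inj_basis]. Qed.

Lemma triangular_arens_michael : arens_michael triangular_space.
Proof.
apply: seminormed_arens_michael.
  move=> _ [p Pp <-] z w; rewrite /tri_seminorm /=.
  have [p0 pD _] := sP Pp; have pM := mP Pp.
  rewrite (@le_trans _ _ (p z.1.1 * p w.1.1 + (p z.1.1 * p w.1.2 + p z.1.2 * p w.2)
      + p z.2 * p w.2))//.
    rewrite lerD ?lerD ?pM// (le_trans (pD _ _))// lerD//.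
  have -> : (p z.1.1 + p z.1.2 + p z.2) * (p w.1.1 + p w.1.2 + p w.2)
    = p z.1.1 * p w.1.1 + (p z.1.1 * p w.1.2 + p z.1.2 * p w.2) + p z.2 * p w.2
    + (p z.1.1 * p w.2 + p z.1.2 * p w.1.1 + p z.1.2 * p w.1.2
       + p z.2 * p w.1.1 + p z.2 * p w.1.2) by ring.
  by rewrite lerDl !addr_ge0// mulr_ge0.
apply: (@seminormed_complete _ _ _ tri_seminorms E tri_inj) => //.
- by apply: complete_lcs_prod => //; exact: complete_lcs_prod.
- exact: tri_inj_basis.
- move=> _ [p Pp <-]; exists [set tri_seminorm p]; split; last first.
    by move=> z e e0; split=> [h _ ->//|]; apply.
  move=> _ ->; split; first by apply: tri_seminorms; exists p.
  move=> e e0; have [_ pc] := defines_topology_ball sP tP Pp.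
  have e3 : 0 < e / 3 by rewrite divr_gt0.
  exists ([set a | p a < e / 3] `*` [set a | p a < e / 3], [set a | p a < e / 3]).
    split=> /=; last exact: pc.
    exists ([set a | p a < e / 3], [set a | p a < e / 3]) => //=.
    by split; exact: pc.
  move=> [[a v] b] [/= [pa pv] pb]; rewrite /tri_seminorm /=.
  have -> : e = e / 3 + e / 3 + e / 3 by field.
  by rewrite !ltrD.
- by move=> G l GF _ Gl; exists l.
Qed.

End TriangularArensMichael.

(** * Twisted derivations and the contraction of the Koszul complex *)

Section TwistedDerivations.
Variables (K : numFieldType) (q : K) (A : tvsAlgType K) (x y : A).
Hypothesis uA : q_universal q x y.

Let amA : arens_michael A. Proof. by case: uA. Qed.

(** A continuous linear condition that is stable under products has only to be
    checked on the generators, by density. *)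
Lemma q_universal_kernel (k : A -> A) : continuous_linear k ->
    k 1 = 0 -> k x = 0 -> k y = 0 ->
    (forall a b, k a = 0 -> k b = 0 -> k (a * b) = 0) ->
  forall a, k a = 0.
Proof.
move=> [kl kc] k1 kx ky kM.
have [k0 kD _ _ kZ] := linear_eqs kl.
apply: (q_universal_dense uA (S := [set a | k a = 0])) => //.
  split; first exact/asboolP.
    move=> c a b /asboolP /= ka /asboolP /= kb; apply/asboolP => /=.
    by rewrite kD kZ ka kb scaler0 addr0.
  by move=> a b /asboolP ka /asboolP kb; exact/asboolP/kM.
move=> G l GF G0 Gl; apply: (cvg_kernel _ kc GF Gl G0).
by case: amA => -[].
Qed.

(** The map [a |-> [[f a, D a], [0, g a]]] is a homomorphism to triangular
    matrices exactly when [D] is a twisted derivation, so the universal property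
    produces [D] from its values [dx], [dy] at the generators. The hypotheses
    are the entries of the commutation relation of the two matrices. *)
Lemma twisted_derivation_ex (x1 y1 dx dy x2 y2 : A) :
    x1 * y1 = q^-1 *: (y1 * x1) ->
    x1 * dy + dx * y2 = q^-1 *: (y1 * dx + dy * x2) ->
    x2 * y2 = q^-1 *: (y2 * x2) ->
  exists (f g : {lrmorphism A -> A}) (D : A -> A),
    [/\ [/\ continuous f, f x = x1 & f y = y1],
        [/\ continuous g, g x = x2 & g y = y2],
        [/\ continuous_linear D, D 1 = 0, D x = dx & D y = dy]
      & forall a b, D (a * b) = f a * D b + D a * g b].
Proof.
move=> h1 hd h2; have [_ _ hom _] := uA.
have [cA [P [sP mP tP]]] := amA.
pose B := triangular_space sP.
have amB : arens_michael B by exact: triangular_arens_michael.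
pose X : B := (x1, dx, x2); pose Y : B := (y1, dy, y2).
have XY : X * Y = q^-1 *: (Y * X).
  have h : (x1 * y1, x1 * dy + dx * y2, x2 * y2) =
    (q^-1 *: (y1 * x1), q^-1 *: (y1 * dx + dy * x2), q^-1 *: (y2 * x2)).
    by rewrite h1 hd h2.
  exact: h.
have [F [Fc FX FY]] := hom B X Y amB XY.
pose F' a : triangular A := F a.
have ic := tri_inj_continuous (sP := sP) tP.
pose E : tvsType K := (A * A * A)%type.
have FE : continuous_linear (fun a => tri_inj (F a) : E).
  split; first by move=> k a b; rewrite linearP.
  move=> a; apply: (@continuous_comp A B E F (@tri_inj K A)); [exact: Fc|exact: ic].
have FM a b : F' (a * b) = tri_mul (F' a) (F' b) by rewrite /F' rmorphM.
have F1 : F' 1 = (1, 0, 1) by rewrite /F' rmorph1.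
have c11 : continuous_linear (fun a => (F' a).1.1).
  exact: clin_comp (@clin_fst _ A A) (clin_comp (@clin_fst _ _ A) FE).
have c12 : continuous_linear (fun a => (F' a).1.2).
  exact: clin_comp (@clin_snd _ A A) (clin_comp (@clin_fst _ _ A) FE).
have c22 : continuous_linear (fun a => (F' a).2).
  exact: clin_comp (@clin_snd _ _ A) FE.
have [||f fE] := @lrmorphism_ex K A A (fun a => (F' a).1.1).
- exact: c11.1.
- by split=> [|a b] /=; [rewrite F1|rewrite FM].
have [||g gE] := @lrmorphism_ex K A A (fun a => (F' a).2).
- exact: c22.1.
- by split=> [|a b] /=; [rewrite F1|rewrite FM].
exists f, g, (fun a => (F' a).1.2); split.
- split; [|by rewrite fE /F' FX|by rewrite fE /F' FY].
  by rewrite (_ : (f : A -> A) = fun a => (F' a).1.1); [exact: c11.2|exact/funext].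
- split; [|by rewrite gE /F' FX|by rewrite gE /F' FY].
  by rewrite (_ : (g : A -> A) = fun a => (F' a).2); [exact: c22.2|exact/funext].
- by split=> //; rewrite /F' ?rmorph1 ?FX ?FY.
- by move=> a b; rewrite FM fE gE.
Qed.

End TwistedDerivations.

Section Koszul.
Variables (K : numFieldType).

(** The maps [(u, v)] and [r] form a continuous contracting homotopy of the
    Koszul complex of [A] at [(l, m)], augmented by the character [e] (which is
    composed with the inclusion of the scalars in [A]). *)
Definition koszul_splitting (q : K) (A : tvsAlgType K) (x y : A) (l m : K) :=
  exists (e : {lrmorphism A -> A}) (u v : A -> A) (r : A * A -> A),
  [/\ [/\ continuous e, e x = l%:A & e y = m%:A],
      [/\ continuous_linear u, continuous_linear v & continuous_linear r],
      forall a, (x - l%:A) * u a + (y - m%:A) * v a = a - e a,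
      forall a b (c := (x - l%:A) * a + (y - m%:A) * b),
        a - u c = (m%:A - q *: y) * r (a, b) /\
        b - v c = (x - (q * l)%:A) * r (a, b)
    & forall a, r ((m%:A - q *: y) * a, (x - (q * l)%:A) * a) = a].

(** With [p] the endomorphism that fixes [x] and kills [y], the derivation [v]
    is the left quotient of [a - p a] by [y], and [u] is the left quotient of
    [p a - e a] by [x - l]. The component of the homotopy in degree 1 is
    [- q^-1 v] because the first entry of the differential is [- q y]. *)
Lemma koszul_splitting_axis (q : K) (A : tvsAlgType K) (x y : A) (l : K) :
  q != 0 -> q_universal q x y -> koszul_splitting q x y l 0.
Proof.
move=> q0 uA; have [amA xy _ uniq] := uA.
have [|||f [g [v [[fc fx fy] [gc gx gy] [vc v1 vx vy] vM]]]] :=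
  @twisted_derivation_ex K q A x y uA (q^-1 *: x) 0 0 1 x y.
- by rewrite mulr0 mul0r scaler0.
- by rewrite mulr1 !mul0r mul1r addr0 add0r.
- exact: xy.
have gid a : g a = a.
  by apply: (uniq A g idfun amA) => //= z; exact: cvg_id.
have [|||e [p [u [[ec ex ey] [pc px py] [uc u1 ux uy] uM]]]] :=
  @twisted_derivation_ex K q A x y uA l%:A 0 1 0 x 0.
- by rewrite mulr0 mul0r scaler0.
- by rewrite !mulr0 !mul0r addr0 scaler0.
- by rewrite mulr0 mul0r scaler0.
have cl (h : {lrmorphism A -> A}) : continuous h -> continuous_linear h.
  by move=> hc; split=> //; exact: linearP.
have fcl := cl _ fc; have pcl := cl _ pc; have ecl := cl _ ec.
have ml := clin_mull amA; have mr := clin_mulr amA.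
(* Moving [p a] across [y] is what turns [v] into the quotient by [y]. *)
have pyf a : p a * y = y * f a.
  apply/eqP; rewrite -subr_eq0; apply/eqP; move: a.
  apply: (q_universal_kernel uA); rewrite ?rmorph1 ?px ?py ?fx ?fy.
  - by apply: clin_sub; [exact: clin_comp (mr y) pcl|exact: clin_comp (ml y) fcl].
  - by rewrite mul1r mulr1 subrr.
  - by rewrite -scalerAr xy subrr.
  - by rewrite mul0r mulr0 subrr.
  - move=> a b /eqP; rewrite subr_eq0 => /eqP pa /eqP; rewrite subr_eq0 => /eqP pb.
    by rewrite !rmorphM -mulrA pb mulrA pa mulrA subrr.
have yv a : y * v a = a - p a.
  apply/eqP; rewrite -subr_eq0; apply/eqP; move: a.
  apply: (q_universal_kernel uA); rewrite ?rmorph1 ?px ?py ?v1 ?vx ?vy.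
  - by apply: clin_sub; [exact: clin_comp (ml y) vc|apply: clin_sub => //; exact: clin_id].
  - by rewrite mulr0 !subrr.
  - by rewrite mulr0 !subrr.
  - by rewrite mulr1 subr0 subrr.
  - move=> a b /eqP; rewrite subr_eq0 => /eqP pa /eqP; rewrite subr_eq0 => /eqP pb.
    rewrite vM gid rmorphM mulrDr !mulrA pa -pyf -mulrA pb.
    by rewrite mulrBr mulrBl [X in X - _]addrC addrA subrK subrr.
have xe a : (x - l%:A) * e a = e a * (x - l%:A).
  apply/eqP; rewrite -subr_eq0; apply/eqP; move: a.
  apply: (q_universal_kernel uA); rewrite ?rmorph1 ?ex ?ey.
  - by apply: clin_sub; [exact: clin_comp (ml _) ecl|exact: clin_comp (mr _) ecl].
  - by rewrite mul1r mulr1 subrr.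
  - by rewrite mulr_algr mulr_algl subrr.
  - by rewrite mul0r mulr0 subrr.
  - move=> a b /eqP; rewrite subr_eq0 => /eqP pa /eqP; rewrite subr_eq0 => /eqP pb.
    by rewrite rmorphM mulrA pa -mulrA pb mulrA subrr.
have xu a : (x - l%:A) * u a = p a - e a.
  apply/eqP; rewrite -subr_eq0; apply/eqP; move: a.
  apply: (q_universal_kernel uA); rewrite ?rmorph1 ?px ?py ?u1 ?ux ?uy ?ex ?ey.
  - by apply: clin_sub; [exact: clin_comp (ml _) uc|exact: clin_sub].
  - by rewrite mulr0 !subrr.
  - by rewrite mulr1 subrr.
  - by rewrite mulr0 !subrr.
  - move=> a b /eqP; rewrite subr_eq0 => /eqP pa /eqP; rewrite subr_eq0 => /eqP pb.
    rewrite uM !rmorphM mulrDr !mulrA pa xe -mulrA pb.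
    by rewrite mulrBr mulrBl [X in X - _]addrC addrA subrK subrr.
have [_ uD _ uB uZ] := linear_eqs uc.1.
have [_ vD _ vB vZ] := linear_eqs vc.1.
have vya a : v (y * a) = a by rewrite vM fy vy gid mul0r add0r mul1r.
have vxa a : v (x * a) = q^-1 *: (x * v a).
  by rewrite vM fx vx mul0r addr0 scalerAl.
have xl a : (x - l%:A) * a = x * a - l *: a by rewrite mulrBl mulr_algl.
exists e, u, v, (fun z => - q^-1 *: v z.1); split.
- by split=> //; rewrite ey scale0r.
- split=> //; apply: clin_scale; apply: clin_comp vc _; exact: clin_fst.
- by move=> a; rewrite scale0r subr0 xu yv addrC addrA subrK.
- move=> a b c; rewrite {}/c scale0r subr0 sub0r /=; split.
    rewrite uD (uM y) ey uy !mul0r !addr0 xl uB uZ uM ex ux mulr_algl mul1r.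
    rewrite addrAC subrr add0r -yv -scalerAr scaleNr -scaleNr.
    by rewrite mulNr -scalerAl scalerN scaleNr opprK scalerA mulVf// scale1r.
  rewrite vD vya xl vB vZ vxa opprD addrC -addrA addNr addr0.
  rewrite -scalerAr mulrBl mulr_algl scalerBr !scaleNr scalerA.
  by rewrite mulrA mulVf// mul1r opprB opprK addrC.
- move=> a; rewrite scale0r sub0r /= mulNr -scalerAl.
  have [_ _ vN _ _] := linear_eqs vc.1.
  by rewrite vN vZ vya scalerN scaleNr opprK scalerA mulVf// scale1r.
Qed.

Lemma q_universal_swap (q : K) (A : tvsAlgType K) (x y : A) :
  q != 0 -> q_universal q x y -> q_universal q^-1 y x.
Proof.
move=> q0 [amA xy hom uniq].
have swap (B : algType K) (X Y : B) : Y * X = q *: (X * Y) -> X * Y = q^-1 *: (Y * X).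
  by move=> ->; rewrite scalerA mulVf// scale1r.
split=> //; rewrite ?invrK.
- by rewrite xy scalerA divff// scale1r.
- move=> B X Y amB XY; have [|g [gc gx gy]] := hom B Y X amB.
    by apply: swap; rewrite XY ?invrK.
  by exists g.
- by move=> B g g' amB gc g'c gy gx; exact: uniq.
Qed.

(** Exchanging the generators exchanges the two summands of [A (+) A] and
    multiplies the differential [A -> A (+) A] by [- q^-1]. *)
Lemma koszul_splitting_swap (q : K) (A : tvsAlgType K) (x y : A) (l m : K) :
  q != 0 -> koszul_splitting q^-1 y x m l -> koszul_splitting q x y l m.
Proof.
move=> q0 [e [u [v [r [[ec ey ex] [uc vc rc] h0 h1 h2]]]]].
have qV a : - q^-1 *: ((x - (q * l)%:A) * a) = (l%:A - q^-1 *: x) * a.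
  rewrite scalerAl; congr (_ * _).
  by rewrite scaleNr scalerBr scalerA mulrA mulVf// mul1r opprB.
have qW a : - q^-1 *: ((m%:A - q *: y) * a) = (y - (q^-1 * m)%:A) * a.
  rewrite scalerAl; congr (_ * _).
  by rewrite scaleNr scalerBr !scalerA mulVf// scale1r opprB.
exists e, v, u, (fun z => - q^-1 *: r (z.2, z.1)); split=> //.
- split=> //; apply: clin_scale; apply: clin_comp rc _.
  by apply: clin_pair; [exact: clin_snd|exact: clin_fst].
- by move=> a; rewrite addrC h0.
- move=> a b c; have [h3 h4] := h1 b a; rewrite [(y - _) * b + _]addrC in h3 h4.
  by rewrite /c h3 h4 /= -!scalerAr qV qW.
- move=> a /=; have [_ _ _ _ rZ] := linear_eqs rc.1.
  by rewrite -rZ -[RHS]h2 -qV -qW.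
Qed.

End Koszul.

(** * Free modules and their tensor products *)

Section FreeModules.
Variables (K : numFieldType) (A : tvsAlgType K).
Hypotheses (amA : arens_michael A) (fA : frechet A).

Let regular_linearl (a : A) : linear (fun v : A => v * a).
Proof. by move=> k u v; rewrite mulrDl scalerAl. Qed.
Let regular_linearr (v : A) : linear (fun a : A => v * a).
Proof. by move=> k a b; rewrite mulrDr scalerAr. Qed.

Definition regular_module : rightFrechetModule A :=
  RightFrechetModule fA regular_linearl regular_linearr (@mulr1 A) (@mulrA A)
    (arens_michael_mul_continuous amA).

Lemma regular_module_map (N : rightFrechetModule A) (n : N) :
  module_map (fun a : regular_module => ract n a).
Proof.
split; last by move=> v a; rewrite /= ractM.
split; first exact: ract_linearr.
move=> a; apply: (@continuous_comp _ _ _ (fun a => (n, a)) (fun z => ract z.1 z.2)).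
  by apply: cvg_pair; [exact: cvg_cst|exact: cvg_id].
exact: ract_continuous.
Qed.

Lemma module_map_regular (N : rightFrechetModule A) (f : regular_module -> N) a :
  module_map f -> f a = ract (f 1) a.
Proof. by move=> [_ fa]; rewrite -fa /= mul1r. Qed.

Lemma regular_projective : projective regular_module.
Proof.
move=> M N f g [fm [s _ fs]] gm.
exists (fun a => ract (s (g 1)) a); first exact: regular_module_map.
by move=> a; have [_ ->] := fm; rewrite fs -module_map_regular.
Qed.

Section ProductModule.
Variables M N : rightFrechetModule A.

Let act (z : (M * N)%type) (a : A) : (M * N)%type := (ract z.1 a, ract z.2 a).

Let act_linearl a : linear (act^~ a).
Proof. by move=> k u v; congr (_, _); exact: ract_linearl. Qed.
Let act_linearr z : linear (act z).
Proof. by move=> k a b; congr (_, _); exact: ract_linearr. Qed.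
Let act1 z : act z 1 = z.
Proof. by case: z => m n; rewrite /act !ract1. Qed.
Let actM z a b : act z (a * b) = act (act z a) b.
Proof. by rewrite /act !ractM. Qed.
Let act_continuous : continuous (fun z : (M * N) * A => act z.1 z.2).
Proof.
move=> z; apply: cvg_pair.
  apply: (@continuous_comp _ _ _ (fun z : (M * N) * A => (z.1.1, z.2))
    (fun z => ract z.1 z.2)); last exact: ract_continuous.
  exact: continuous_fst_snd.
apply: (@continuous_comp _ _ _ (fun z : (M * N) * A => (z.1.2, z.2))
  (fun z => ract z.1 z.2)); last exact: ract_continuous.
exact: continuous_snd_snd.
Qed.

Definition product_module : rightFrechetModule A :=
  RightFrechetModule (frechet_prod (rmod_frechet M) (rmod_frechet N))
    act_linearl act_linearr act1 actM act_continuous.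

Lemma module_map_pair (L : rightFrechetModule A) (f : L -> M) (g : L -> N) :
  module_map f -> module_map g ->
  module_map (fun v => (f v, g v) : product_module).
Proof.
move=> [fc fa] [gc ga]; split; first exact: clin_pair.
by move=> v a; rewrite fa ga.
Qed.

Lemma module_map_copair (L : rightFrechetModule A) (f : M -> L) (g : N -> L) :
  module_map f -> module_map g ->
  module_map (fun z : product_module => f z.1 + g z.2).
Proof.
move=> [fc fa] [gc ga]; split.
  apply: clin_add; first exact: clin_comp fc (@clin_fst _ M N).
  exact: clin_comp gc (@clin_snd _ M N).
move=> v a /=; rewrite fa ga.
by have [_ -> _ _ _] := linear_eqs (ract_linearl (r := L) a).
Qed.

Lemma module_map_inl : module_map (fun m : M => (m, 0) : product_module).
Proof. exact: module_map_pair (module_map_id M) (module_map_zero M N). Qed.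

Lemma module_map_inr : module_map (fun n : N => (0, n) : product_module).
Proof. exact: module_map_pair (module_map_zero N M) (module_map_id N). Qed.

Lemma product_linear_split (E : lmodType K) (f : (M * N)%type -> E) z : linear f ->
  f z = f (z.1, 0) + f (0, z.2).
Proof.
case: z => m n fl; have [_ <- _ _ _] := linear_eqs fl; congr f.
by congr (_, _); rewrite /= ?addr0 ?add0r.
Qed.

Lemma product_projective : projective M -> projective N -> projective product_module.
Proof.
move=> pM pN L1 L2 f g fe gm.
have [h1 h1m fh1] := pM _ _ _ _ fe (module_map_comp gm module_map_inl).
have [h2 h2m fh2] := pN _ _ _ _ fe (module_map_comp gm module_map_inr).
exists (fun z => h1 z.1 + h2 z.2); first exact: module_map_copair.
move=> z; have [_ fD _ _ _] := linear_eqs (module_map_linear fe.1).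
have gl : linear (g : (M * N)%type -> L2) by exact: (module_map_linear gm).
by rewrite fD fh1 fh2 [RHS](product_linear_split z gl).
Qed.

End ProductModule.

Lemma zero_module_ex : exists Z : rightFrechetModule A, forall z : Z, z = 0.
Proof.
have [|Z [i [im ii i0 _]]] := @kernel_module K A regular_module A id (clin_id A)
    (frechet_hausdorff fA).
  by move=> v a ->; rewrite /= mul0r.
exists Z => z; apply: ii; rewrite i0.
by have [-> _ _ _ _] := linear_eqs (module_map_linear im).
Qed.

Section Tensors.
Variable X : leftFrechetModule A.

(** A balanced map [b] is determined by [b 1], whence [A (x) X = X]. *)
Lemma tensor_regular :
  tensor_product (fun (a : regular_module) (v : X) => lact a v).
Proof.
split; first exact: lmod_frechet.
  split.
  - exact: lact_linearl.
  - exact: lact_linearr.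
  - exact: lact_continuous.
  - by move=> y a v; rewrite /= lactM.
move=> E b cE [bl br bc ba]; exists (b 1); split.
- split; first exact: br.
  move=> v; apply: (@continuous_comp _ _ _ (fun v => (1 : A, v)) (fun z => b z.1 z.2)).
    by apply: cvg_pair; [exact: cvg_cst|exact: cvg_id].
  exact: bc.
- by move=> a v; rewrite -ba /= mul1r.
- by move=> f _ fb v; rewrite -fb lact1.
Qed.

Lemma tensor_prod (M N : rightFrechetModule A) (T U : tvsType K)
    (t : M -> X -> T) (u : N -> X -> U) :
  tensor_product t -> tensor_product u ->
  tensor_product (T := (T * U)%type)
    (fun (z : product_module M N) (v : X) => (t z.1 v, u z.2 v)).
Proof.
move=> tT uU; have [fT [tl tr tc tb] tu] := tT; have [fU [ul ur uc ub] uu] := uU.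
split; first exact: frechet_prod.
  split.
  - by move=> v k z w; congr (_, _); [exact: tl|exact: ul].
  - by move=> z k v w; congr (_, _); [exact: tr|exact: ur].
  - move=> z; apply: cvg_pair.
      apply: (@continuous_comp _ _ _ (fun z : (M * N) * X => (z.1.1, z.2))
        (fun z => t z.1 z.2)); last exact: tc.
      exact: continuous_fst_snd.
    apply: (@continuous_comp _ _ _ (fun z : (M * N) * X => (z.1.2, z.2))
      (fun z => u z.1 z.2)); last exact: uc.
    exact: continuous_snd_snd.
  - by move=> z a v; congr (_, _); [exact: tb|exact: ub].
move=> E b cE [bl br bc ba].
have balanced_comp (L : rightFrechetModule A) (j : L -> product_module M N) :
    module_map j -> balanced (fun m v => b (j m) v).
  move=> [[jl jc] ja]; split.
  - by move=> v k m n; rewrite jl bl.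
  - by move=> m; exact: br.
  - move=> z; apply: (@continuous_comp _ _ _ (fun z : L * X => (j z.1, z.2) : (product_module M N * X)%type)
      (fun z => b z.1 z.2)); last exact: bc.
    exact: continuous_map_fst.
  - by move=> m a v; rewrite ja ba.
have [f [fc ft _]] := tu E _ cE (balanced_comp _ _ (@module_map_inl M N)).
have [g [gc gu _]] := uu E _ cE (balanced_comp _ _ (@module_map_inr M N)).
exists (fun z => f z.1 + g z.2); split.
- apply: clin_add; first exact: clin_comp fc (@clin_fst _ T U).
  exact: clin_comp gc (@clin_snd _ T U).
- by move=> z v; rewrite /= ft gu -(product_linear_split (f := b^~ v)).
move=> f' f'c f't z.
have inl_c : continuous_linear (fun m : T => (m, 0) : (T * U)%type).
  exact: clin_pair (clin_id _) (clin_zero _ _).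
have inr_c : continuous_linear (fun n : U => (0, n) : (T * U)%type).
  exact: clin_pair (clin_zero _ _) (clin_id _).
have h1 : (fun m => f' (m, 0)) =1 f.
  apply: (tensor_ext tT cE) => //; first exact: clin_comp f'c inl_c.
  move=> m v; rewrite ft -f't /=.
  by have [-> _ _ _ _] := linear_eqs (ul v).
have h2 : (fun n => f' (0, n)) =1 g.
  apply: (tensor_ext uU cE) => //; first exact: clin_comp f'c inr_c.
  move=> n v; rewrite gu -f't /=.
  by have [-> _ _ _ _] := linear_eqs (tl v).
have -> : f' z = f' (z.1, 0) + f' (0, z.2).
  case: z => m n; have [_ <- _ _ _] := linear_eqs f'c.1; congr f'.
  by congr (_, _); rewrite /= ?addr0 ?add0r.
by rewrite -h1 -h2.
Qed.

Lemma tensor_zero (Z : rightFrechetModule A) : (forall z : Z, z = 0) ->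
  tensor_product (T := Z) (fun (z : Z) (v : X) => 0 : Z).
Proof.
move=> Z0; split; first exact: rmod_frechet.
  split=> //.
  - by move=> v k z w; rewrite [RHS]Z0.
  - by move=> z k v w; rewrite [RHS]Z0.
  - by move=> z; exact: cvg_cst.
move=> E b cE [bl br bc ba]; exists (fun=> 0); split.
- exact: clin_zero.
- by move=> z v; rewrite (Z0 z); have [-> _ _ _ _] := linear_eqs (bl v).
- move=> f' [f'l _] _ z; rewrite (Z0 z).
  by have [-> _ _ _ _] := linear_eqs f'l.
Qed.

End Tensors.
End FreeModules.

(** * The Koszul resolution *)

Section KoszulResolution.
Variables (R : realType).
Local Notation C := R[i].
Variables (q : C) (A : tvsAlgType C) (x y : A).
Hypothesis uA : q_universal q x y.
Variables (chi : {lrmorphism A -> C^o}) (chi_cont : continuous chi).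
Local Notation l := (chi x : C).
Local Notation m := (chi y : C).

Let amA : arens_michael A. Proof. by case: uA. Qed.
Let fA : frechet A. Proof. exact: q_universal_frechet uA. Qed.
Let xy : x * y = q^-1 *: (y * x). Proof. by case: uA. Qed.

Local Notation FA := (regular_module amA fA).
Local Notation Y := (character_module chi_cont).

Definition koszul_diff0 (z : A * A) : A := (x - l%:A) * z.1 + (y - m%:A) * z.2.
Definition koszul_diff1 (a : A) : A * A :=
  ((m%:A - q *: y) * a, (x - (q * l)%:A) * a).

Lemma mull_module_map (c : A) : module_map (fun a : FA => c * a : FA).
Proof. by split=> [|v a]; [exact: clin_mull|exact: mulrA]. Qed.

Lemma koszul_diff0_map :
  module_map (koszul_diff0 : product_module FA FA -> FA).
Proof. exact: (module_map_copair (mull_module_map _) (mull_module_map _)). Qed.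

Lemma koszul_diff1_map :
  module_map (koszul_diff1 : FA -> product_module FA FA).
Proof. exact: (module_map_pair (mull_module_map _) (mull_module_map _)). Qed.

Lemma character_map : module_map (chi : FA -> Y).
Proof.
split; last by move=> v a; rewrite /= rmorphM.
by split=> //; exact: linearP.
Qed.

(** In the composite, left multiplication by an element of [A], the relation
    between [x] and [y] leaves only the scalar [(q - 1) l m]. *)
Lemma koszul_diff_diff (q0 : q != 0) (lm : l * m = 0) a :
  koszul_diff0 (koszul_diff1 a) = 0.
Proof.
rewrite /koszul_diff0 /koszul_diff1 /= !mulrA -mulrDl.
suff -> : (x - l%:A) * (m%:A - q *: y) + (y - m%:A) * (x - (q * l)%:A) = 0.
  by rewrite mul0r.
have -> : (x - l%:A) * (m%:A - q *: y) = m *: x - y * x + (q * l) *: y.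
  rewrite mulrBl !mulrBr !mulr_algl mulr_algr -scalerAr xy !scalerA.
  by rewrite divff// scale1r lm scale0r sub0r opprK [l * q]mulrC.
have -> : (y - m%:A) * (x - (q * l)%:A) = y * x - (q * l) *: y - m *: x.
  rewrite mulrBl !mulrBr !mulr_algl mulr_algr !scalerA.
  by rewrite mulrCA [m * l]mulrC lm mulr0 scale0r subr0.
by apply/eqP; rewrite addr_eq0 !opprB addrC addrA addrAC addrC.
Qed.

(* The zero module, in degrees 3 and higher. *)
Variables (Z : rightFrechetModule A) (Z0 : forall z : Z, z = 0).

Definition koszul_mod (n : nat) : rightFrechetModule A :=
  match n with 0 => FA | 1 => product_module FA FA | 2 => FA | _ => Z end.

Definition koszul_diff (n : nat) : koszul_mod n.+1 -> koszul_mod n :=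
  match n with
  | 0 => koszul_diff0 | 1 => koszul_diff1 | 2 => fun=> 0 | _ => fun=> 0
  end.

Lemma koszul_resolution : q != 0 -> l * m = 0 -> koszul_splitting q x y l m ->
  projective_resolution (Y := Y) koszul_diff (chi : koszul_mod 0 -> Y).
Proof.
move=> q0 lm [e [u [v [r [[ec ex ey] [uc vc rc] h0 h1 h2]]]]].
have zero_proj : projective Z.
  move=> M N f g [fm _] [gc _]; exists (fun=> 0); first exact: module_map_zero.
  move=> z; rewrite (Z0 z); have [-> _ _ _ _] := linear_eqs gc.1.
  by have [-> _ _ _ _] := linear_eqs (module_map_linear fm).
split.
  case=> [|[|[|n]]] //; [exact: regular_projective| |exact: regular_projective].
  by apply: product_projective; exact: regular_projective.
have cdm : forall n, module_map (@koszul_diff n).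
  case=> [|[|[|n]]]; [exact: koszul_diff0_map|exact: koszul_diff1_map|
    exact: module_map_zero|exact: module_map_zero].
have chiZ k : chi k%:A = k by rewrite linearZ /= rmorph1 [LHS]mulr1.
have eE a : e a = (chi a)%:A.
  have [_ _ _ uniq] := uA.
  have lin : linear (fun a => (chi a)%:A : A).
    by move=> k b c; rewrite linearP scalerDl scalerA.
  have mon : monoid_morphism (fun a => (chi a)%:A : A).
    split=> [|b c]; first by rewrite rmorph1 scale1r.
    by rewrite rmorphM mulr_algl scalerA.
  have [f fE] := lrmorphism_ex lin mon.
  rewrite -fE; apply: (uniq A e f amA); rewrite ?fE ?ex ?ey//.
  rewrite (_ : (f : A -> A) = fun a => (chi a : C^o) *: (1 : A)); last exact/funext.
  move=> z; apply: (@continuous_comp A (C^o * A)%type A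
    (fun a => (chi a, 1)) (fun z => z.1 *: z.2)); last exact: scale_continuous.
  by apply: (@cvg_pair _ _ _ (nbhs z) (nbhs (chi z)) (nbhs (1 : A)));
    [exact: chi_cont|exact: cvg_cst].
split.
- exact: character_map.
- exact: cdm.
- move=> z; rewrite /= /koszul_diff0 rmorphD !rmorphM !rmorphB /= !chiZ.
  by rewrite !subrr !mul0r addr0.
- case=> [|[|[|n]]] v' //=; first exact: koszul_diff_diff.
    by have [-> _ _ _ _] := linear_eqs (module_map_linear koszul_diff1_map).
pose h n : koszul_mod n -> koszul_mod n.+1 := match n with
  | 0 => fun a => (u a, v a) | 1 => r | 2 => fun=> 0 | _ => fun=> 0 end.
exists (fun k : C^o => (k : C)%:A), h; split.
- split; first by move=> k b c; rewrite scalerDl scalerA.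
  move=> z; apply: (@continuous_comp C^o (C^o * A)%type A
    (fun k => (k, 1)) (fun z => z.1 *: z.2)); last exact: scale_continuous.
  by apply: (@cvg_pair _ _ _ (nbhs z) (nbhs z) (nbhs (1 : A)));
    [exact: cvg_id|exact: cvg_cst].
- case=> [|[|[|n]]]; [exact: clin_pair|exact: rc|exact: clin_zero|exact: clin_zero].
- exact: chiZ.
- by move=> a; rewrite /= /koszul_diff0 /= h0 eE subrK.
- case=> [|[|[|n]]] z /=.
  + case: z => a b; have [h3 h4] := h1 a b; rewrite /koszul_diff1 -h3 -h4.
    by congr (_, _); rewrite /koszul_diff0 /= subrK.
  + by rewrite /koszul_diff1 h2 add0r.
  + by rewrite [RHS]Z0 addr0.
  + by rewrite [RHS]Z0 addr0.
Qed.

Variable X : leftFrechetModule A.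

Definition koszul_tensor (n : nat) : tvsType C :=
  match n with 0 => X | 1 => (X * X)%type | 2 => X | _ => Z end.

Definition koszul_act (n : nat) : koszul_mod n -> X -> koszul_tensor n :=
  match n with
  | 0 => fun a v => lact a v
  | 1 => fun z v => (lact z.1 v, lact z.2 v)
  | 2 => fun a v => lact a v
  | _ => fun _ _ => 0
  end.

Lemma koszul_act_tensor n : tensor_product (@koszul_act n).
Proof.
case: n => [|[|[|n]]]; [exact: tensor_regular| |exact: tensor_regular|
  exact: tensor_zero].
exact: tensor_prod (tensor_regular _ _ X) (tensor_regular _ _ X).
Qed.

Variables (T S : X -> X).
Hypotheses (T_cont : continuous_linear T) (S_cont : continuous_linear S).
Hypotheses (xT : forall v, lact x v = T v) (yS : forall v, lact y v = S v).

Definition koszul_space_diff (n : nat) : koszul_tensor n.+1 -> koszul_tensor n :=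
  match n with
  | 0 => koszul_d1 T S (l, m) | 1 => koszul_d0 q T S (l, m)
  | 2 => fun=> 0 | _ => fun=> 0
  end.

Lemma koszul_space_diff_clin n : continuous_linear (@koszul_space_diff n).
Proof.
case: n => [|[|[|n]]]; [| |exact: clin_zero|exact: clin_zero].
  apply: clin_add; apply: clin_sub.
  - exact: clin_comp T_cont (@clin_fst _ X X).
  - exact: clin_scale (@clin_fst _ X X).
  - exact: clin_comp S_cont (@clin_snd _ X X).
  - exact: clin_scale (@clin_snd _ X X).
apply: clin_pair; apply: clin_sub => //; apply: clin_scale => //; exact: clin_id.
Qed.

Lemma koszul_space_diff_act n p v :
  koszul_space_diff (@koszul_act n.+1 p v) = koszul_act (koszul_diff p) v.
Proof.
have lB a b w : lact (a - b) w = lact a w - lact b w :> X.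
  by have [_ _ _ -> _] := linear_eqs (lact_linearl (l := X) w).
have lD a b w : lact (a + b) w = lact a w + lact b w :> X.
  by have [_ -> _ _ _] := linear_eqs (lact_linearl (l := X) w).
have lZ k a w : lact (k *: a) w = k *: lact a w :> X.
  by have [_ _ _ _ ->] := linear_eqs (lact_linearl (l := X) w).
case: n p => [|[|[|n]]] p /=.
- by rewrite /koszul_diff0 /koszul_d1 lD !lactM !lB !lZ !lact1 xT yS.
- by rewrite /koszul_diff1 /koszul_d0 /= !lactM !lB !lZ !lact1 xT yS.
- by have [-> _ _ _ _] := linear_eqs (lact_linearl (l := X) v).
- by [].
Qed.

(** Exactness at the left end of the complex of [(T, S)] is the vanishing of
    homology in degree 2, since the tensor product vanishes in degree 3. *)
Lemma koszul_exact_homology : koszul_exact q T S (l, m) <->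
  forall k, homology_vanishes koszul_space_diff k.
Proof.
split=> [[e0 e1 e2] [|[|[|k]]] /=|h].
- exact: e2.
- exact: e1.
- rewrite e0; apply/seteqP; split=> [v ->|_ [z _ <-]//].
  by exists 0.
- apply/seteqP; split=> z _; last by rewrite /= (Z0 z); case: k z => [|k] z /=.
  by exists 0 => //; rewrite (Z0 z).
split; [|exact: (h 1)|exact: (h 0)].
have /= -> := h 2; apply/seteqP; split=> [_ [z _ <-]//|_ ->].
by exists 0.
Qed.

Lemma koszul_exact_Tor :
  q != 0 -> l * m = 0 -> koszul_splitting q x y l m ->
  koszul_exact q T S (l, m) <-> forall k, Tor_vanishes Y X k.
Proof.
move=> q0 lm spl.
have E k := Tor_vanishes_resolution k (koszul_resolution q0 lm spl)
  koszul_act_tensor koszul_space_diff_clin koszul_space_diff_act.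
rewrite koszul_exact_homology; split=> h k; exact/E.
Qed.

End KoszulResolution.

(** * Spectrum and resolvent set *)

(* Joins the topology and the algebra structure of the field of scalars. *)
HB.instance Definition _ (K : numFieldType) := GRing.Algebra.on K^o.

Lemma complex_arens_michael (R : realType) : arens_michael (R[i]^o : tvsAlgType R[i]).
Proof.
have [cC _] := complex_frechet R; split=> //.
exists [set Num.norm : R[i]^o -> R[i]]; split.
- by move=> _ ->; split; [exact: normr_ge0|exact: ler_normD|exact: normrM].
- by move=> _ -> a b; rewrite normrM.
move=> U; split=> [/nbhs_ballP[e /= e0 eU]|[F [e [F1 _ e0 FU]]]].
  exists [set Num.norm : R[i]^o -> R[i]], e; split=> [//|//|//|z].
  by move=> /(_ _ erefl) ze; apply: eU; rewrite -ball_normE /= sub0r normrN.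
apply/nbhs_ballP; exists e => //= z; rewrite -ball_normE /= sub0r normrN => ze.
by apply: FU => p /F1 ->.
Qed.

Lemma q_universal_character (R : realType) (q : R[i]) (A : tvsAlgType R[i])
    (x y : A) (l m : R[i]) : q_universal q x y -> l * m = 0 ->
  exists chi : {lrmorphism A -> R[i]^o}, [/\ continuous chi, chi x = l & chi y = m].
Proof.
move=> [_ _ hom _] lm; apply: (hom (R[i]^o : tvsAlgType R[i])).
  exact: complex_arens_michael.
by rewrite [LHS]lm [m * l]mulrC [l * m]lm scaler0.
Qed.

Theorem lemma3p1 (R : realType) (q : R[i]) (q0 : q != 0) (q1 : q != 1)
    (Oq : tvsAlgType R[i]) (w : {lrmorphism quantum_plane q -> Oq})
    (w_envelope : arens_michael_envelope w)
    (X : leftFrechetModule Oq) (T S : X -> X)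
    (T_cont : continuous_linear T) (S_cont : continuous_linear S)
    (TS : forall v, T (S v) = q^-1 *: S (T v))
    (xT : forall v, lact (w (qx q)) v = T v)
    (yS : forall v, lact (w (qy q)) v = S v) :
  joint_spectrum q T S = @Cxy R `\` resolvent_set w X.
Proof.
have uA := envelope_q_universal w_envelope.
have [Z Z0] := zero_module_ex (let: And4 h _ _ _ := uA in h) (q_universal_frechet uA).
have axes (l m : R[i]) : Cxy (l, m) -> l * m = 0.
  by move=> [[_ /= ->]|[/= -> _]]; rewrite ?mulr0 ?mul0r.
have spl (l m : R[i]) : Cxy (l, m) ->
    koszul_splitting q (w (qx q)) (w (qy q)) l m.
  move=> [[_ /= ->]|[/= -> _]]; first exact: koszul_splitting_axis.
  apply: koszul_splitting_swap => //; apply: koszul_splitting_axis.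
    by rewrite invr_eq0.
  exact: q_universal_swap.
have exact_iff (l m : R[i]) (chi : {lrmorphism Oq -> R[i]^o}) (cc : continuous chi) :
    Cxy (l, m) -> chi (w (qx q)) = l -> chi (w (qy q)) = m ->
    koszul_exact q T S (l, m) <-> forall k, Tor_vanishes (character_module cc) X k.
  move=> lm cx cy; subst l m.
  by apply: koszul_exact_Tor => //; [exact: axes|exact: spl].
apply/seteqP; split=> -[l m] [lm].
  move=> nex; split=> // -[_ [chi [cc [cx cy tor]]]]; apply: nex.
  by apply/(exact_iff l m chi cc).
move=> nres; split=> // ex; apply: nres; split=> //.
have [chi [cc cx cy]] := q_universal_character uA (axes _ _ lm).
by exists chi, cc; split=> //; apply/(exact_iff l m chi cc).
Qed.
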